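(* Let $\beta>n$ and let $X$ be a random variable in $\mathbb{R}^n$ with density $f$ that is $-1/\beta$-concave. Let $\widetilde{h}(X)=-\log f(X)$ and $h(X)=-\int_{\mathbb{R}^n}f\log f\,dx$. Then for every $\alpha<1-n/\beta$, $$\mathbb{E}\, e^{\alpha(\widetilde{h}(X)-h(X))}\le e^{\psi_c(\alpha)},\qquad \psi_c(\alpha)=-\alpha\beta\sum_{i=1}^n(\beta-i)^{-1}-\sum_{i=1}^n\log\frac{(1-\alpha)\beta-i}{\beta-i}.$$ Moreover, equality holds when $X$ has a Pareto distribution, i.e. density $f(x)=Z_n(a,\beta)^{-1}(a+x_1+\cdots+x_n)^{-\beta}$ for $x_1,\dots,x_n>0$ (and $0$ otherwise), where $a>0$ and $Z_n(a,\beta)$ is the normalizing constant.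
   Context: A function $f:\mathbb{R}^n\to[0,\infty)$ is $-1/\beta$-concave ($\beta>0$) if $f((1-\lambda)x+\lambda y)\ge\big((1-\lambda)f(x)^{-1/\beta}+\lambda f(y)^{-1/\beta}\big)^{-\beta}$ for all $x,y$ with $f(x)f(y)>0$ and all $\lambda\in[0,1]$; equivalently $f^{-1/\beta}$ is convex on the support of $f$. *)

(* Defs.v *)
From HB Require Import structures.
From mathcomp Require Import all_boot all_order all_algebra.
From mathcomp Require Import all_classical all_reals all_analysis.
Set Implicit Arguments. Unset Strict Implicit. Unset Printing Implicit Defensive.
Import Order.TTheory GRing.Theory Num.Theory.
Local Open Scope classical_set_scope.
Local Open Scope ring_scope.

(* Points of R^n are represented as n.-tuple R (which carries the product
   sigma-algebra generated by the coordinates in mathcomp-analysis). *)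

Section Rn.
Variable R : realType.

Fixpoint iter_lebesgue_integral (n : nat) : (n.-tuple R -> \bar R) -> \bar R :=
  match n with
  | 0 => fun F => F [tuple]
  | n'.+1 => fun F =>
      (\int[@lebesgue_measure R]_(t in [set: R])
          iter_lebesgue_integral (fun x : n'.-tuple R => F [tuple of t :: x]))%E
  end.

Definition lebesgue_n (n : nat) : set (n.-tuple R) -> \bar R :=
  fun A => iter_lebesgue_integral (fun x => ((\1_A x : R))%:E).

Definition tcomb (n : nat) (l : R) (x y : n.-tuple R) : n.-tuple R :=
  [tuple (1 - l) * tnth x i + l * tnth y i | i < n].

Definition neg_inv_concave (n : nat) (beta : R) (f : n.-tuple R -> R) : Prop :=
  forall x y (l : R), 0 < f x * f y -> 0 <= l <= 1 ->
    powR ((1 - l) * powR (f x) (- beta^-1) + l * powR (f y) (- beta^-1)) (- beta)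
      <= f (tcomb l x y).

Definition is_density (n : nat) (f : n.-tuple R -> R) : Prop :=
  measurable_fun [set: n.-tuple R] f /\ (forall x, 0 <= f x) /\
  (\int[@lebesgue_n n]_x (f x)%:E = 1)%E.

Definition entropy (n : nat) (f : n.-tuple R -> R) : \bar R :=
  (- \int[@lebesgue_n n]_x (f x * ln (f x))%:E)%E.

Definition exp_moment (n : nat) (f : n.-tuple R -> R) (alpha : R) : \bar R :=
  (\int[@lebesgue_n n]_x
     ((f x)%:E * expeR (alpha%:E * ((- ln (f x))%:E - entropy f))))%E.

Definition psi_c (n : nat) (beta alpha : R) : R :=
  - alpha * beta * (\sum_(1 <= i < n.+1) (beta - i%:R)^-1)
  - \sum_(1 <= i < n.+1) ln (((1 - alpha) * beta - i%:R) / (beta - i%:R)).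

Definition pareto_unnorm (n : nat) (a beta : R) (x : n.-tuple R) : R :=
  if [forall i, 0 < tnth x i]
  then powR (a + \sum_(i < n) tnth x i) (- beta) else 0.

Definition pareto_Z (n : nat) (a beta : R) : R :=
  fine (\int[@lebesgue_n n]_x (pareto_unnorm a beta x)%:E)%E.

Definition pareto_density (n : nat) (a beta : R) (x : n.-tuple R) : R :=
  (pareto_Z n a beta)^-1 * pareto_unnorm a beta x.

End Rn.

(* Main.v *)
Require Import Defs.
From HB Require Import structures.
From mathcomp Require Import all_boot all_order all_algebra.
From mathcomp Require Import all_classical all_reals all_analysis.
From mathcomp Require Import measurable_realfun.
From mathcomp Require Import ring lra.
Set Implicit Arguments. Unset Strict Implicit. Unset Printing Implicit Defensive.
Import Order.TTheory GRing.Theory Num.Theory.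
Import numFieldNormedType.Exports.
Local Open Scope classical_set_scope.
Local Open Scope ring_scope.

(** Neither finiteness of the entropy nor boundedness of [f] is assumed; both are forced. Markov
    gives [V t <= t^beta], and since [beta > n] this is too small near 0 for a concave [V^(1/n)]
    that stays positive, so [V] vanishes near 0. Concavity also bounds [V t] by a multiple of [t^n]
    away from 0. Hence every integral with [q > n] converges; with [q = (1 - alpha) * beta] this is
    exactly [alpha < 1 - n / beta].

    The two orthogonality relations come from total mass one, which is the case [q = beta], and from
    equality of entropies, which is the derivative in [q] at [beta]. Matching the entropy is
    possible because the entropy of the Pareto density is affine in [ln a] with slope [n]; its
    exponential moment does not depend on [a], so the choice costs nothing. In dimension 0 the slope
    vanishes, and that case is computed directly. *)

(** Write [f = phi^(-beta)] with [phi] convex.  By the Brunn-Minkowski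
    inequality the volume [V t] of [{phi < t}] is such that [V^(1/n)] is concave,
    and all the quantities in the statement are integrals of [V]:
    [int f^(q/beta) = int q t^(-q-1) V t dt], with a similar formula for the
    entropy.  For the Pareto density the corresponding volume [W] is a multiple
    of [(t/k - a)_+^n], so that [W^(1/n)] is affine where it is positive; hence
    [{W < V}] is an interval.  Choose [a] so that the Pareto density has the
    entropy of [f].  Then [V - W] is orthogonal to [t^(-beta-1)] and to
    [t^(-beta-1) ln t], and subtracting from [t^(beta-q)], a convex function of
    [ln t], its chord through the ends of [{W < V}] gives
    [int t^(-q-1) (V - W) <= 0].  So the Pareto density maximizes the
    exponential moment at fixed entropy, and its own moments are explicit. *)

(** * Lebesgue measure on tuples as an iterated product *)

Section cons_measure.
Context {R : realType}.
Local Open Scope ereal_scope.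

Definition tcons (n : nat) (p : R * n.-tuple R) : n.+1.-tuple R :=
  [tuple of p.1 :: p.2].

Definition tuncons (n : nat) (x : n.+1.-tuple R) : R * n.-tuple R :=
  (thead x, [tuple of behead x]).

Lemma tconsK n : cancel (@tcons n) (@tuncons n).
Proof.
move=> [t x]; rewrite /tcons /tuncons theadE; congr pair.
exact/val_inj.
Qed.

Lemma measurable_tcons n : measurable_fun setT (@tcons n).
Proof. by apply: measurable_cons; [exact: measurable_fst|exact: measurable_snd]. Qed.

Lemma measurable_tuncons n : measurable_fun setT (@tuncons n).
Proof.
apply/measurable_fun_pairP; split => /=.
  exact: measurable_tnth.
exact: measurable_behead.
Qed.

Lemma measurable_preimage_tcons n (A : set (n.+1.-tuple R)) :
  measurable A -> measurable (@tcons n @^-1` A).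
Proof. by move=> mA; rewrite -[X in measurable X]setTI; exact: measurable_tcons. Qed.

Section def.
Variables (n : nat) (m : {sigma_finite_measure set (n.-tuple R) -> \bar R}).

Definition cons_measure (A : set (n.+1.-tuple R)) : \bar R :=
  (@lebesgue_measure R \x m) (@tcons n @^-1` A).

Let cons_measure0 : cons_measure set0 = 0.
Proof. by rewrite /cons_measure preimage_set0 measure0. Qed.

Let cons_measure_ge0 A : 0 <= cons_measure A.
Proof. exact: measure_ge0. Qed.

Let cons_measure_sigma_additive : semi_sigma_additive cons_measure.
Proof.
move=> F mF tF mUF; rewrite /cons_measure preimage_bigcup.
apply: measure_semi_sigma_additive.
- by move=> k; exact: measurable_preimage_tcons.
- apply/trivIsetP => /= i j _ _ ij; rewrite -preimage_setI.
  by move/trivIsetP : tF => /(_ _ _ _ _ ij) ->//; rewrite preimage_set0.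
- by rewrite -preimage_bigcup; exact: measurable_preimage_tcons.
Qed.

HB.instance Definition _ := isMeasure.Build _ _ _ cons_measure
  cons_measure0 cons_measure_ge0 cons_measure_sigma_additive.

Let cons_measure_sigma_finite : sigma_finite setT cons_measure.
Proof.
have /sigma_finiteP[F [TF ndF Foo]] := sigma_finiteT (@lebesgue_measure R).
have /sigma_finiteP[G [TG ndG Goo]] := sigma_finiteT m.
exists (fun i => @tuncons n @^-1` (F i `*` G i)).
  rewrite -preimage_bigcup (_ : \bigcup_i _ = setT) ?preimage_setT//.
  rewrite -setXTT TF TG predeqE => -[x y]; split.
    by move=> [k _ []/= ? ?]; split; exists k.
  move=> [/= [k _ Fx] [l _ Gy]]; exists (maxn k l) => //; split.
  - by move: x Fx; exact/subsetPset/ndF/leq_maxl.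
  - by move: y Gy; exact/subsetPset/ndG/leq_maxr.
move=> i; have [mFi Fioo] := Foo i; have [mGi Gioo] := Goo i; split.
  by rewrite -[X in measurable X]setTI; apply: measurable_tuncons => //; exact:
    measurableX.
rewrite /cons_measure -comp_preimage (_ : _ \o _ = id) ?preimage_id//.
  by rewrite product_measure1E// lte_mul_pinfty// ge0_fin_numE.
by apply/funext => p /=; rewrite tconsK.
Qed.

HB.instance Definition _ := Measure_isSigmaFinite.Build _ _ _ cons_measure
  cons_measure_sigma_finite.

Lemma ge0_integral_cons_measure (F : n.+1.-tuple R -> \bar R) :
  measurable_fun [set: n.+1.-tuple R] F -> (forall x, 0 <= F x) ->
  \int[cons_measure]_x F x =
  \int[@lebesgue_measure R]_t \int[m]_x F [tuple of t :: x].
Proof.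
move=> mF F0.
have mFc : measurable_fun [set: measurableTypeR R * n.-tuple R] (F \o @tcons n).
  exact: (measurableT_comp mF (@measurable_tcons n)).
rewrite -[RHS](@fubini_tonelli1 _ _ _ _ _ (@lebesgue_measure R) m _ mFc); last first.
  by move=> x; exact: F0.
exact: (@ge0_integral_pushforward _ _ (measurableTypeR R * n.-tuple R)%type
  _ _ _ (@measurable_tcons n) (@lebesgue_measure R \x m) setT F measurableT mF (fun y _
    => F0 y)).
Qed.

End def.

(* [lebesgue_n] is only given as a set function; on measurable sets it agrees
   with this measure, which makes it a measure. *)
Fixpoint lebesgue_rec (n : nat) : {sigma_finite_measure set (n.-tuple R) -> \bar R} :=
  match n with
  | 0 => @dirac _ (0.-tuple R) [tuple] R
  | n'.+1 => cons_measure (lebesgue_rec n')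
  end.

Lemma lebesgue_n_rec n (A : set (n.-tuple R)) : measurable A ->
  @lebesgue_n R n A = lebesgue_rec n A.
Proof.
elim: n A => [|n IH] A mA.
  by rewrite /lebesgue_n /= diracE indicE.
rewrite /= /cons_measure /product_measure1/=.
rewrite /lebesgue_n /=; apply: eq_integral => t _.
have mAt : measurable (xsection (@tcons n @^-1` A) t).
  by apply: measurable_xsection; exact: measurable_preimage_tcons.
rewrite -IH//.
rewrite /lebesgue_n; congr (iter_lebesgue_integral _).
apply/funext => x; rewrite !indicE; congr ((nat_of_bool _)%:R%:E).
apply/idP/idP; rewrite !inE/xsection/= inE//.
Qed.

Lemma lebesgue_n0 n : @lebesgue_n R n set0 = 0.
Proof. by rewrite lebesgue_n_rec// measure0. Qed.

Lemma iter_lebesgue_integral_ge0 n (F : n.-tuple R -> \bar R) :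
  (forall x, 0 <= F x) -> 0 <= iter_lebesgue_integral F.
Proof.
elim: n F => [|n IH] F F0 //=.
by apply: integral_ge0 => t _; exact: IH.
Qed.

Lemma lebesgue_n_ge0 n (A : set (n.-tuple R)) : 0 <= @lebesgue_n R n A.
Proof. by apply: iter_lebesgue_integral_ge0 => x; rewrite lee_fin. Qed.

Lemma lebesgue_n_sigma_additive n : semi_sigma_additive (@lebesgue_n R n).
Proof.
move=> F mF tF mUF; rewrite lebesgue_n_rec//.
under eq_fun do under eq_bigr do rewrite lebesgue_n_rec//.
exact: measure_semi_sigma_additive.
Qed.

HB.instance Definition _ n := isMeasure.Build _ _ _ (@lebesgue_n R n)
  (@lebesgue_n0 n) (@lebesgue_n_ge0 n) (@lebesgue_n_sigma_additive n).

Lemma lebesgue_n_sigma_finite n : sigma_finite setT (@lebesgue_n R n).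
Proof.
have [F FT mF] := sigma_finiteT (lebesgue_rec n).
exists F => // i; have [mFi Fioo] := mF i; split => //.
by rewrite /= lebesgue_n_rec.
Qed.

HB.instance Definition _ n := Measure_isSigmaFinite.Build _ _ _ (@lebesgue_n R n)
  (@lebesgue_n_sigma_finite n).

Lemma ge0_integral_lebesgue_nS n (F : n.+1.-tuple R -> \bar R) :
  measurable_fun [set: n.+1.-tuple R] F -> (forall x, 0 <= F x) ->
  \int[@lebesgue_n R n.+1]_x F x =
  \int[@lebesgue_measure R]_t \int[@lebesgue_n R n]_x F [tuple of t :: x].
Proof.
move=> mF F0; rewrite (eq_measure_integral (lebesgue_rec n.+1)); last first.
  by move=> A mA _; exact: lebesgue_n_rec.
rewrite /= ge0_integral_cons_measure//; apply: eq_integral => t _.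
by apply: eq_measure_integral => A mA _; exact/esym/lebesgue_n_rec.
Qed.

Lemma integral_lebesgue_0 (F : 0.-tuple R -> \bar R) :
  \int[@lebesgue_n R 0]_x F x = F [tuple].
Proof.
rewrite (eq_measure_integral (lebesgue_rec 0)); last first.
  by move=> A mA _; exact: lebesgue_n_rec.
rewrite /= integral_dirac//; first by rewrite diracT mul1e.
move=> _ A mA; rewrite setTI.
(* Over a one-point space every set is empty or full, which makes [F] measurable. *)
have [->|->] : F @^-1` A = set0 \/ F @^-1` A = setT; last 2 first.
  exact: measurable0.
  exact: measurableT.
have [A0|A0] := pselect (A (F [tuple])); [right|left]; apply/seteqP; split => // x;
  by rewrite /= (tuple0 x).
Qed.

End cons_measure.

(** * The Brunn-Minkowski inequality *)

Section brunn_minkowski_1d.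
Context {R : realType}.
Local Notation leb := (@lebesgue_measure R).
Local Open Scope ereal_scope.

Lemma measurable_affine (c d : R) :
  measurable_fun [set: R] (fun y : R => ((y - d) / c)%R).
Proof. by apply: measurable_funM => //; exact: measurable_funB. Qed.

(** The set on the left is [c * A + d]. The rescaled pushforward of Lebesgue measure gives half-open
    intervals their length, so uniqueness identifies the two. *)
Lemma lebesgue_measure_affine (c d : R) (A : set R) : (0 < c)%R -> measurable A ->
  leb [set y : R | A ((y - d) / c)%R] = c%:E * leb A.
Proof.
move=> c0 mA; have ci0 : (0 <= c^-1)%R by rewrite invr_ge0 ltW.
pose mu1 := mscale (NngNum ci0)
  (pushforward leb ((fun y : R => ((y - d) / c)%R) : _ -> measurableTypeR R)).
pose mu0 := mu1 (measurable_affine c d).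
suff -> : leb A = mu0 A.
  by rewrite /mu0 /mu1 /mscale/= muleA -EFinM divff ?gt_eqF// mul1e.
apply: lebesgue_measure_unique => //=.
move=> _ [[a b]] _ <-; rewrite /mu0 /mu1 /mscale/= /pushforward.
rewrite (_ : _ @^-1` _ = `](a * c + d)%R, (b * c + d)%R]%classic).
  rewrite !lebesgue_measure_itv/= !lte_fin ltrD2r ltr_pM2r//.
  case: ifP => ab; last by rewrite mule0.
  by rewrite -!EFinB -EFinM; congr EFin; field; rewrite gt_eqF.
by apply/seteqP; split => y /=; rewrite !in_itv/= ltr_pdivlMr// ler_pdivrMr//
  ltrBrDr lerBlDr.
Qed.

Lemma measurable_affine_preimage (c d : R) (A : set R) : measurable A ->
  measurable [set y : R | A ((y - d) / c)%R].
Proof. by move=> mA; rewrite -[X in measurable X]setTI; exact: measurable_affine. Qed.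

(** With [a = max K] and [b = min L], the sets [(1 - l) * K + l * b] and [(1 - l) * a + l * L] both
    lie in [C], the first to the left of [p = (1 - l) * a + l * b] and the second to its right. They
    meet at most in the null set [[set p]], so their measures add. *)
Lemma brunn_minkowski_compact (K L C : set R) (l : R) : (0 < l < 1)%R ->
  compact K -> compact L -> measurable C -> K !=set0 -> L !=set0 ->
  (forall a b, K a -> L b -> C ((1 - l) * a + l * b)%R) ->
  (1 - l)%:E * leb K + l%:E * leb L <= leb C.
Proof.
move=> /andP[l0 l1] cK cL mC K0 L0 KLC.
have l10 : (0 < 1 - l)%R by rewrite subr_gt0.
have [a Ka amax] : exists2 a, K a & forall x, K x -> (x <= a)%R.
  have [a /set_mem Ka amax] := compact_EVT_max K0 cK (@continuous_subspaceT _ _ K id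
    (fun _ => cvg_id)).
  by exists a => // x Kx; apply: amax; rewrite inE.
have [b Lb bmin] : exists2 b, L b & forall x, L x -> (b <= x)%R.
  have [b /set_mem Lb bmin] := compact_EVT_min L0 cL (@continuous_subspaceT _ _ L id
    (fun _ => cvg_id)).
  by exists b => // x Lx; apply: bmin; rewrite inE.
have mK : measurable K by exact: compact_measurable.
have mL : measurable L by exact: compact_measurable.
set S1 := [set y : R | K ((y - l * b) / (1 - l))%R].
set S2 := [set y : R | L ((y - (1 - l) * a) / l)%R].
have mS1 : measurable S1 by exact: measurable_affine_preimage.
have mS2 : measurable S2 by exact: measurable_affine_preimage.
rewrite -(@lebesgue_measure_affine (1 - l) (l * b))// -(@lebesgue_measure_affine l ((1
  - l) * a))//.
rewrite -/S1 -/S2.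
pose p := ((1 - l) * a + l * b)%R.
have mp : measurable [set p] by exact: measurable_set1.
apply: (@le_trans _ _ (leb S1 + leb (S2 `\` [set p]))).
  apply: leeD2l; apply: (@le_trans _ _ (leb (S2 `\` [set p] `|` [set p]))).
    apply: le_measure; rewrite ?inE//.
      by apply: measurableU => //; exact: measurableD.
    by move=> y Sy; have [->|yp] := pselect (y = p); [right|left; split].
  rewrite -[leRHS]adde0 -(lebesgue_measure_set1 p).
  by apply: measureU2 => //; exact: measurableD.
rewrite -measureU//; last 2 first.
- exact: measurableD.
- apply/seteqP; split => // y [] S1y [S2y] /= yp; apply: yp.
  apply/eqP; rewrite eq_le /p; apply/andP; split.
  + by have := amax _ S1y; rewrite ler_pdivrMr// lerBlDr mulrC.
  + by have := bmin _ S2y; rewrite ler_pdivlMr// lerBrDr mulrC addrC.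
apply: le_measure; rewrite ?inE//.
  by apply: measurableU => //; exact: measurableD.
move=> y [S1y|[S2y _]].
- suff -> : y = ((1 - l) * ((y - l * b) / (1 - l)) + l * b)%R by exact: KLC.
  by field; rewrite gt_eqF.
- suff -> : y = ((1 - l) * a + l * ((y - (1 - l) * a) / l))%R by exact: KLC.
  by field; rewrite gt_eqF.
Qed.

Lemma brunn_minkowski_real (A B C : set R) (l : R) : (0 < l < 1)%R ->
  measurable A -> measurable B -> measurable C -> A !=set0 -> B !=set0 ->
  (forall a b, A a -> B b -> C ((1 - l) * a + l * b)%R) ->
  (1 - l)%:E * leb A + l%:E * leb B <= leb C.
Proof.
move=> l01 mA mB mC [a0 Aa0] [b0 Bb0] ABC.
have /andP[l0 l1] := l01.
have l10 : (0 < 1 - l)%R by rewrite subr_gt0.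
have [->|Coo] := eqVneq (leb C) +oo; first by rewrite leey.
have Cfin : leb C \is a fin_num.
  by rewrite ge0_fin_numE// ltey.
(* Inner regularity also produces empty compact sets; adjoining [a0] and [b0] keeps both sets
   non-empty. *)
have key K L : compact K -> K `<=` A -> compact L -> L `<=` B ->
    (1 - l)%:E * leb K + l%:E * leb L <= leb C.
  move=> cK KA cL LB.
  have cK' : compact (K `|` [set a0]) by apply: compactU => //; exact: compact_set1.
  have cL' : compact (L `|` [set b0]) by apply: compactU => //; exact: compact_set1.
  have mK : measurable K by exact: compact_measurable.
  have mL : measurable L by exact: compact_measurable.
  have mK' : measurable (K `|` [set a0]) by exact: compact_measurable.
  have mL' : measurable (L `|` [set b0]) by exact: compact_measurable.
  apply: (@le_trans _ _ ((1 - l)%:E * leb (K `|` [set a0]) + l%:E * leb (L `|` [set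
    b0]))).
    apply: leeD; rewrite lee_pmul2l ?lte_fin//.
      by apply: le_measure; rewrite ?inE//; exact: subsetUl.
    by apply: le_measure; rewrite ?inE//; exact: subsetUl.
  apply: brunn_minkowski_compact => //.
  - by exists a0; right.
  - by exists b0; right.
  - by move=> a b [/KA Aa|->] [/LB Bb|->]; exact: ABC.
have stepA L : compact L -> L `<=` B -> (1 - l)%:E * leb A + l%:E * leb L <= leb C.
  move=> cL LB.
  have Lfin : l%:E * leb L \is a fin_num.
    by rewrite fin_numM// ge0_fin_numE//; exact: compact_finite_measure.
  rewrite -leeBrDr// -lee_pdivlMl// (lebesgue_regularity_inner_sup mA).
  apply: ge_ereal_sup => _ [K [cK KA] <-].
  by rewrite lee_pdivlMl// leeBrDr//; exact: key.
(* Taking [L] empty bounds the measure of [A] by that of [C], and the finiteness allows the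
   subtraction below. *)
have Afin : (1 - l)%:E * leb A \is a fin_num.
  rewrite ge0_fin_numE; last by rewrite mule_ge0 // lee_fin ltW.
  have := stepA set0 (@compact0 _) (@sub0set _ _).
  by rewrite measure0 mule0 adde0 => /le_lt_trans; apply; rewrite ltey.
rewrite -leeBrDl// -lee_pdivlMl// (lebesgue_regularity_inner_sup mB).
apply: ge_ereal_sup => _ [L [cL LB] <-].
by rewrite lee_pdivlMl// leeBrDl//; exact: stepA.
Qed.

End brunn_minkowski_1d.

(** * The one-dimensional inequality applied level by level *)

Section brunn_minkowski_unit.
Context {R : realType}.
Local Notation leb := (@lebesgue_measure R).
Local Open Scope ereal_scope.

Lemma tonelli_sections d1 d2 (T1 : measurableType d1) (T2 : measurableType d2)
    (m1 : {sigma_finite_measure set T1 -> \bar R})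
    (m2 : {sigma_finite_measure set T2 -> \bar R}) (U : set (T1 * T2)) :
  measurable U ->
  \int[m1]_x m2 (xsection U x) = \int[m2]_y m1 (ysection U y).
Proof.
move=> mU; have := indic_fubini_tonelli m1 m2 mU.
by rewrite indic_fubini_tonelli_FE// indic_fubini_tonelli_GE.
Qed.

(** Levels 0 and 1 are left out: at level 0 the section would be the whole line, and a function of
    supremum 1 need not reach level 1. *)
Definition unit_hypograph (G : R -> \bar R) : set (measurableTypeR R * measurableTypeR
  R) :=
  [set p : R * R | (0 < p.2 < 1)%R /\ p.2%:E <= G p.1].

Lemma measurable_unit_hypograph (G : R -> \bar R) : measurable_fun [set: R] G ->
  measurable (unit_hypograph G).
Proof.
move=> mG.
rewrite (_ : unit_hypograph G = (setT `*` `]0%R, 1%R[%classic) `&`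
   ([set: measurableTypeR R * measurableTypeR R] `&` [set p : R * R | p.2%:E <= G
     p.1])); last first.
  apply/seteqP; split => -[s t] /=; rewrite /unit_hypograph/= in_itv/=; tauto.
apply: measurableI.
  by apply: measurableX => //; exact: measurable_itv.
apply: measurable_lee => //.
  apply/measurable_EFinP; exact: measurable_snd.
exact: (measurableT_comp mG (@measurable_fst _ _ (measurableTypeR R) (measurableTypeR
  R))).
Qed.

Lemma integral_mine1 (G : R -> \bar R) : measurable_fun [set: R] G ->
  (forall s, 0 <= G s) ->
  \int[leb]_s mine (G s) 1 = \int[leb]_u leb (ysection (unit_hypograph G) u).
Proof.
move=> mG G0.
rewrite -(tonelli_sections leb leb (measurable_unit_hypograph mG)).
apply: eq_integral => s _.
have [G1|G1] := leP (G s) 1.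
- have [g Gg] : exists g, G s = g%:E.
    by exists (fine (G s)); rewrite fineK// ge0_fin_numE// (le_lt_trans G1)// ltry.
  have g0 : (0 <= g)%R by rewrite -lee_fin -Gg.
  have g1 : (g <= 1)%R by rewrite -lee_fin -Gg.
  (* The section lies between the open and the half-open interval from 0 to [g], which have the same
     length; whether [g] itself belongs to it depends on [g < 1]. *)
  rewrite Gg; apply/eqP; rewrite eq_le; apply/andP; split.
  + apply: (@le_trans _ _ (leb `]0%R, g[%classic)).
      by rewrite lebesgue_measure_itv/= lte_fin; case: ltP => [_|]; rewrite ?sube0//
        lee_fin.
    apply: le_measure; rewrite ?inE; [exact: measurable_itv| |].
      by apply: measurable_xsection; exact: measurable_unit_hypograph.
    move=> u /=; rewrite in_itv/= => /andP[u0 ug]; apply/xsectionP.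
    by rewrite /unit_hypograph/= u0 Gg lee_fin ltW// (lt_le_trans ug).
  + apply: (@le_trans _ _ (leb `]0%R, g]%classic)); last first.
      by rewrite lebesgue_measure_itv/= lte_fin; case: ltP => [_|]; rewrite ?sube0//
        lee_fin.
    apply: le_measure; rewrite ?inE; [|exact: measurable_itv|].
      by apply: measurable_xsection; exact: measurable_unit_hypograph.
    by move=> u /xsectionP; rewrite /unit_hypograph/= Gg lee_fin in_itv/= => -[/andP[->
      _] ->].
- transitivity (leb (`]0%R, 1%R[%classic : set R)).
    by rewrite lebesgue_measure_itv/= lte_fin ltr01 sube0.
  apply/esym; congr (leb _); apply/seteqP; split => u /=.
      by move/xsectionP; rewrite /unit_hypograph/= in_itv/= => -[].
    rewrite in_itv/= => u01; apply/xsectionP; split => //=.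
    case/andP: u01 => _ u1.
    by apply: le_trans (ltW G1); rewrite lee_fin ltW.
Qed.

(** For each [u] in the open unit interval the superlevel sets of [GA], [GB] and [GC] satisfy
    [brunn_minkowski_real]; integrating over [u] gives the claim. Truncation at 1 restricts to
    levels where the sets of [GA] and [GB] are non-empty. *)
Lemma brunn_minkowski_unit (GA GB GC : R -> \bar R) (l : R) : (0 < l < 1)%R ->
  measurable_fun [set: R] GA -> measurable_fun [set: R] GB -> measurable_fun [set: R]
    GC ->
  (forall s, 0 <= GA s) -> (forall s, 0 <= GB s) -> (forall s, 0 <= GC s) ->
  (forall u : R, (0 < u < 1)%R -> exists s, u%:E <= GA s) ->
  (forall u : R, (0 < u < 1)%R -> exists s, u%:E <= GB s) ->
  (forall u s s' : R, (0 < u < 1)%R -> u%:E <= GA s -> u%:E <= GB s' ->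
    u%:E <= GC ((1 - l) * s + l * s')%R) ->
  (1 - l)%:E * (\int[leb]_s mine (GA s) 1) + l%:E * (\int[leb]_s mine (GB s) 1) <=
  \int[leb]_s mine (GC s) 1.
Proof.
move=> l01 mA mB mC A0 B0 C0 Ae Be ABC.
rewrite !integral_mine1//.
have mU := measurable_unit_hypograph.
have l0 : (0 <= l)%R by case/andP: l01 => /ltW.
have l10 : (0 <= 1 - l)%R by case/andP: l01 => _ /ltW; rewrite subr_ge0.
have mys G (mG : measurable_fun [set: R] G) := measurable_fun_ysection leb (mU G mG).
rewrite -!ge0_integralZl ?lee_fin//; try exact: mys.
rewrite -ge0_integralD//; last 4 first.
- by move=> u _; rewrite mule_ge0.
- by apply: measurable_funeM; exact: mys.
- by move=> u _; rewrite mule_ge0.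
- by apply: measurable_funeM; exact: mys.
apply: ge0_le_integral => //.
- by move=> u _; rewrite adde_ge0// mule_ge0.
- by apply: emeasurable_funD; apply: measurable_funeM; exact: mys.
- exact: mys.
move=> u _ /=.
have ysE G : ysection (unit_hypograph G) u = [set s | (0 < u < 1)%R /\ u%:E <= G s].
  by apply/seteqP; split => s /=; [move/ysectionP|move=> ?; apply/ysectionP].
have [u01|u01] := boolP (0 < u < 1)%R; last first.
  have ys0 G : ysection (unit_hypograph G) u = set0.
    by rewrite ysE; apply/seteqP; split => // s /= []; rewrite (negbTE u01).
  by rewrite !ys0 !measure0 !mule0 adde0.
apply: brunn_minkowski_real => //; try by apply: measurable_ysection; exact: mU.
- by have [s us] := Ae _ u01; exists s; rewrite ysE.
- by have [s us] := Be _ u01; exists s; rewrite ysE.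
- by move=> s s'; rewrite !ysE /= => -[_ us] [_ us']; split => //; exact: ABC.
Qed.

End brunn_minkowski_unit.

(** * Convexity of the perspective of a power, and truncation *)

Section brunn_minkowski.
Context {R : realType}.
Local Notation leb := (@lebesgue_measure R).

(** The left-hand side is the tangent at [r] of the power [z ^+ n.+1]. *)
Lemma bernoulli_homogeneous n (z r : R) : 0 <= z -> 0 <= r ->
  n.+1%:R * z * r ^+ n - n%:R * r ^+ n.+1 <= z ^+ n.+1.
Proof.
move=> z0 r0; elim: n => [|n IH]; first by rewrite !expr1 mul0r subr0 expr0 mul1r mulr1.
have : z * (n.+1%:R * z * r ^+ n - n%:R * r ^+ n.+1) <= z * z ^+ n.+1 by exact: ler_wpM2l.
rewrite -exprS; apply: le_trans.
rewrite -subr_ge0.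
rewrite [leRHS](_ : _ = n.+1%:R * r ^+ n * (z - r) ^+ 2); last first.
  have -> : n.+2%:R = n%:R + 2 :> R by rewrite -addn2 natrD.
  by rewrite !exprS -natr1; ring.
by rewrite mulr_ge0 ?sqr_ge0// mulr_ge0// exprn_ge0.
Qed.

(** Joint convexity of the perspective [z ^+ n.+1 / c ^+ n]. The tangent at the ratio [r = X / M] of
    the combined arguments is linear in [(z, c)], lies below the perspective at [(x, a)] and
    [(y, b)], and is exact at [(X, M)]. *)
Lemma perspective_power_convex n (l x y a b : R) : 0 < l < 1 ->
  0 < x -> 0 < y -> 0 < a -> 0 < b ->
  ((1 - l) * x + l * y) ^+ n.+1 <=
  ((1 - l) * a + l * b) ^+ n *
    ((1 - l) * (x ^+ n.+1 / a ^+ n) + l * (y ^+ n.+1 / b ^+ n)).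
Proof.
move=> /andP[l0 l1] x0 y0 a0 b0; have l10 : 0 < 1 - l by rewrite subr_gt0.
set X := (1 - l) * x + l * y; set M := (1 - l) * a + l * b.
have X0 : 0 < X by rewrite addr_gt0 ?mulr_gt0.
have M0 : 0 < M by rewrite addr_gt0 ?mulr_gt0.
pose r := X / M; have r0 : 0 <= r by rewrite divr_ge0 ?ltW.
have tangent (z c : R) : 0 < z -> 0 < c ->
    n.+1%:R * z * r ^+ n - n%:R * c * r ^+ n.+1 <= z ^+ n.+1 / c ^+ n.
  move=> z0 c0.
  have := @bernoulli_homogeneous n (z / c) r (ltW (divr_gt0 z0 c0)) r0.
  rewrite -(ler_pM2l c0); congr (_ <= _).
    by field; rewrite gt_eqF.
  rewrite expr_div_n [c ^+ n.+1]exprS; field.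
  by rewrite expf_neq0 gt_eqF.
rewrite mulrC -ler_pdivrMr ?exprn_gt0//.
apply: le_trans (lerD (ler_wpM2l (ltW l10) (tangent x a x0 a0))
  (ler_wpM2l (ltW l0) (tangent y b y0 b0))).
rewrite [leRHS](_ : _ = n.+1%:R * X * r ^+ n - n%:R * M * r ^+ n.+1); last first.
  by rewrite /X /M; ring.
rewrite /r !expr_div_n !exprS -natr1 le_eqVlt; apply/orP; left; apply/eqP; field.
by rewrite expf_neq0 gt_eqF.
Qed.

Local Open Scope ereal_scope.

Lemma cvg_mine_nat (x : \bar R) : mine x k%:R%:E @[k --> \oo] --> x.
Proof.
case: x => [r| |].
- apply: cvg_near_cst; near=> k; rewrite min_l// lee_fin; near: k.
  exact: nbhs_infty_ger.
- under eq_fun do rewrite min_r ?leey//.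
  by apply/cvgeryP; exact: cvgr_idn.
- under eq_fun do rewrite min_l ?leNye//.
  exact: cvg_cst.
Unshelve. all: by end_near. Qed.

(** Slice volumes are to be divided by their supremum, which may be infinite. By monotone
    convergence a truncation of [F] at a large integer still has integral above [p]; [m] is the
    supremum of that truncation. *)
Lemma integral_truncate (F : R -> \bar R) (p : R) : measurable_fun [set: R] F ->
  (forall s, 0 <= F s) -> (0 < p)%R -> p%:E < \int[leb]_s F s ->
  exists2 m : R, (0 < m)%R &
    (forall u : R, (0 < u < 1)%R -> exists s, (u * m)%:E <= F s) /\
    p%:E <= \int[leb]_s mine (F s) m%:E.
Proof.
move=> mF F0 p0 pF.
pose g k s := mine (F s) k%:R%:E.
have mg k : measurable_fun [set: R] (g k) by apply: measurable_mine.
have g0 k s : 0 <= g k s by rewrite le_min F0 lee_fin/=.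
have [k pk] : exists k, p%:E < \int[leb]_s g k s.
  apply: contrapT => /forallNP H.
  have : \int[leb]_s F s <= p%:E; last by rewrite leNgt pF.
  have gnd s : {homo g^~ s : n m / (n <= m)%N >-> n <= m}.
    move=> i j ij; rewrite /g le_min ge_min lexx/= ge_min; apply/orP; right.
    by rewrite lee_fin ler_nat.
  have -> : \int[leb]_s F s = \int[leb]_s limn (g^~ s).
    by apply: eq_integral => s _; apply/esym/cvg_lim => //; exact: cvg_mine_nat.
  have cg := @cvg_monotone_convergence _ _ _ leb _ measurableT g mg
    (fun n x _ => g0 n x) (fun x _ => gnd x).
  rewrite -(cvg_lim _ cg)//; apply: lime_le; first by apply/cvg_ex; eexists; exact: cg.
  by near=> i; rewrite leNgt; exact/negP/H.
pose S := ereal_sup (range (g k)).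
have gS s : g k s <= S by apply: ereal_sup_ubound; exists s.
have Sk : S <= k%:R%:E by apply: ge_ereal_sup => _ [s _ <-]; rewrite /g ge_min lexx orbT.
have S0 : 0 < S.
  rewrite ltNge; apply/negP => S0; move: pk.
  rewrite integral0_eq; last first.
    by move=> s _; apply/eqP; rewrite eq_le g0 (le_trans (gS s)).
  by rewrite lte_fin ltNge ltW.
have Sfin : S \is a fin_num.
  by rewrite ge0_fin_numE ?ltW// (le_lt_trans Sk)// ltry.
have SE : (fine S)%:E = S by rewrite fineK.
exists (fine S); first by rewrite -lte_fin SE.
split.
  move=> u /andP[u0 u1].
  have : (u * fine S)%:E < S.
    by rewrite -[ltRHS]SE lte_fin gtr_pMl// -lte_fin SE.
  move=> /ereal_sup_gt[_ [s _ <-]] us; exists s.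
  by apply: (le_trans (ltW us)); rewrite /g ge_min lexx.
rewrite SE; apply: (le_trans (ltW pk)); apply: ge0_le_integral => //.
- exact: measurable_mine.
- exact: measurable_mine.
- by move=> s _; rewrite le_min gS /g ge_min lexx.
Unshelve. all: by end_near. Qed.

End brunn_minkowski.

(** * Induction on the dimension by slicing *)

Section brunn_minkowski_n.
Context {R : realType}.
Local Notation leb := (@lebesgue_measure R).

Lemma root_exists n (m : R) : (0 < n)%N -> 0 < m -> exists2 a : R, 0 < a & a ^+ n = m.
Proof.
move=> n0 m0; exists (powR m n%:R^-1); first exact: powR_gt0.
by rewrite -powR_mulrn ?powR_ge0// -powRrM mulVf ?powRr1 ?ltW// pnatr_eq0 -lt0n.
Qed.

Lemma tcomb_cons n (l s s' : R) (x y : n.-tuple R) :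
  tcomb l [tuple of s :: x] [tuple of s' :: y] =
  [tuple of (1 - l) * s + l * s' :: tcomb l x y].
Proof.
apply: eq_from_tnth => i; rewrite tnth_mktuple.
have [->|i0] := eqVneq i ord0; first by rewrite !(tnth_nth 0).
have [j ->] : exists j, i = lift ord0 j.
  by case: (unliftP ord0 i) i0 => [j ->|->]; [exists j|rewrite eqxx].
by rewrite !tnthS tnth_mktuple.
Qed.

Local Open Scope ereal_scope.

Definition slice n (A : set (n.+1.-tuple R)) (t : R) : set (n.-tuple R) :=
  [set x : n.-tuple R | A [tuple of t :: x]].

Lemma sliceE n (A : set (n.+1.-tuple R)) t :
  slice A t = xsection (@tcons R n @^-1` A) t.
Proof. by apply/seteqP; split => x /=; [move=> ?; apply/xsectionP|move/xsectionP]. Qed.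

Lemma measurable_slice n (A : set (n.+1.-tuple R)) t :
  measurable A -> measurable (slice A t).
Proof.
move=> mA; rewrite sliceE; apply: measurable_xsection.
exact: measurable_preimage_tcons.
Qed.

Lemma measurable_fun_slice n (A : set (n.+1.-tuple R)) : measurable A ->
  measurable_fun [set: R] (fun t => @lebesgue_n R n (slice A t)).
Proof.
move=> mA; under eq_fun do rewrite sliceE.
exact: (measurable_fun_xsection (@lebesgue_n R n) (measurable_preimage_tcons mA)).
Qed.

Lemma lebesgue_nS n (A : set (n.+1.-tuple R)) :
  @lebesgue_n R n.+1 A = \int[leb]_t @lebesgue_n R n (slice A t).
Proof.
apply: eq_integral => t _; rewrite /lebesgue_n; congr (iter_lebesgue_integral _).
Qed.

(* [FA], [FB], [FC] are the volumes of the slices; after dividing them by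
   (truncated) suprema, their level sets satisfy the one-dimensional inequality. *)
Lemma brunn_minkowski_step n (FA FB FC : R -> \bar R) (l x y : R) :
  (0 < n)%N -> (0 < l < 1)%R ->
  measurable_fun [set: R] FA -> measurable_fun [set: R] FB -> measurable_fun [set: R]
    FC ->
  (forall s, 0 <= FA s) -> (forall s, 0 <= FB s) -> (forall s, 0 <= FC s) ->
  (forall (s s' x y : R), (0 < x)%R -> (0 < y)%R ->
    (x ^+ n)%:E <= FA s -> (y ^+ n)%:E <= FB s' ->
    (((1 - l) * x + l * y) ^+ n)%:E <= FC ((1 - l) * s + l * s')%R) ->
  (0 < x)%R -> (0 < y)%R ->
  (x ^+ n.+1)%:E <= \int[leb]_s FA s -> (y ^+ n.+1)%:E <= \int[leb]_s FB s ->
  (((1 - l) * x + l * y) ^+ n.+1)%:E <= \int[leb]_s FC s.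
Proof.
move=> n0 l01 mA mB mC A0 B0 C0 ABC x0 y0 xA yB.
have /andP[l0 l1] := l01.
have l10 : (0 < 1 - l)%R by rewrite subr_gt0.
have X0 : (0 < (1 - l) * x + l * y)%R by rewrite addr_gt0 ?mulr_gt0.
(* [integral_truncate] needs a strict lower bound on the integral, so a factor [rho < 1] is given
   away and recovered in the limit. *)
apply/lee_mul01Pr; first by rewrite lee_fin exprn_ge0 ?ltW.
move=> rho /andP[rho0 rho1].
have trunc F z : measurable_fun [set: R] F -> (forall s, 0 <= F s) -> (0 < z)%R ->
    (z ^+ n.+1)%:E <= \int[leb]_s F s ->
    exists2 a : R, (0 < a)%R & (forall u : R, (0 < u < 1)%R ->
      exists s, u%:E <= F s * (a ^+ n)^-1%:E) /\
      (rho * (z ^+ n.+1 / a ^+ n))%:E <= \int[leb]_s mine (F s * (a ^+ n)^-1%:E) 1.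
  move=> mF F0 z0 zF.
  have [||m m0 [Fs Fi]] := @integral_truncate _ F (rho * z ^+ n.+1) mF F0.
  - by rewrite mulr_gt0 ?exprn_gt0.
  - by apply: lt_le_trans zF; rewrite lte_fin gtr_pMl ?exprn_gt0.
  have [a a0 am] := root_exists n0 m0.
  exists a => //; rewrite am; split.
    by move=> u u01; have [s us] := Fs u u01; exists s; rewrite lee_pdivlMr.
  have -> : \int[leb]_s mine (F s * m^-1%:E) 1 = \int[leb]_s (mine (F s) m%:E * m^-1%:E).
    apply: eq_integral => s _; rewrite mine_pMl ?lee_fin ?invr_ge0 ?ltW//.
    by rewrite -EFinM divff// gt_eqF.
  rewrite ge0_integralZr//; last 3 first.
  - exact: measurable_mine.
  - by move=> s _; rewrite le_min F0 lee_fin ltW.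
  - by rewrite lee_fin invr_ge0 ltW.
  by rewrite mulrA EFinM; apply: lee_wpmul2r => //; rewrite lee_fin invr_ge0 ltW.
have [a a0 [As Ai]] := trunc FA x mA A0 x0 xA.
have [b b0 [Bs Bi]] := trunc FB y mB B0 y0 yB.
(* The roots [a] and [b] of the two suprema combine linearly, as roots of volumes do in dimension
   [n]; this is the matching normalization for [FC]. *)
pose c := ((1 - l) * a + l * b)%R.
have c0 : (0 < c)%R by rewrite addr_gt0 ?mulr_gt0.
have cn0 : (0 < c ^+ n)%R by rewrite exprn_gt0.
have mZ F (k : R) : measurable_fun [set: R] F -> measurable_fun [set: R] (fun s => F s
  * k%:E).
  by move=> mF; apply: emeasurable_funM.
have Z0 F (k : R) : (0 < k)%R -> (forall s : R, 0 <= F s) ->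
    (forall s : R, 0 <= F s * (k ^+ n)^-1%:E).
  by move=> k0 F0 s; rewrite mule_ge0 // lee_fin invr_ge0 exprn_ge0 // ltW.
have := @brunn_minkowski_unit _ _ _ _ l l01 (mZ _ (a ^+ n)^-1%R mA) (mZ _ (b ^+ n)^-1%R
  mB)
  (mZ _ (c ^+ n)^-1%R mC) (Z0 _ _ a0 A0) (Z0 _ _ b0 B0) (Z0 _ _ c0 C0) As Bs.
have H (u s s' : R) : (0 < u < 1)%R ->
   u%:E <= FA s * (a ^+ n)^-1%:E -> u%:E <= FB s' * (b ^+ n)^-1%:E ->
   u%:E <= FC ((1 - l) * s + l * s')%R * (c ^+ n)^-1%:E.
  move=> /andP[u0 u1].
  rewrite !lee_pdivlMr ?exprn_gt0// -!EFinM.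
  (* With [u = v ^+ n] the levels become the powers of [v * a] and [v * b], whose combination is
     [v * c]. *)
  have [v v0 vu] := root_exists n0 u0.
  rewrite -vu -!exprMn => ua ub.
  have -> : (v * c = (1 - l) * (v * a) + l * (v * b))%R by rewrite /c; ring.
  by apply: ABC => //; rewrite mulr_gt0.
move=> /(_ H) unit_le.
have le1 : (1 - l)%:E * (rho * (x ^+ n.+1 / a ^+ n))%:E +
    l%:E * (rho * (y ^+ n.+1 / b ^+ n))%:E <= \int[leb]_s mine (FC s * (c ^+ n)^-1%:E) 1.
  by apply: le_trans unit_le; apply: leeD; apply: lee_wpmul2l => //;
    rewrite lee_fin ltW.
have le2 : \int[leb]_s mine (FC s * (c ^+ n)^-1%:E) 1 <= (\int[leb]_s FC s) * (c ^+
  n)^-1%:E.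
  rewrite -ge0_integralZr//; last by rewrite lee_fin invr_ge0 ltW.
  apply: ge0_le_integral => //.
  - by move=> s _; rewrite le_min lee01 andbT; exact: Z0.
  - by apply: measurable_mine => //; exact: mZ.
  - exact: mZ.
  - by move=> s _; rewrite ge_min lexx.
have := le_trans le1 le2; rewrite lee_pdivlMr//; apply: le_trans.
rewrite -!EFinM lee_fin.
have := @perspective_power_convex _ n l x y a b l01 x0 y0 a0 b0.
move=> /(ler_wpM2l (ltW rho0)); rewrite -/c => persp; apply: le_trans persp _.
by rewrite le_eqVlt; apply/orP; left; apply/eqP; ring.
Qed.

(* Lower bounds [x ^+ n] stand for [n]-th roots, so that infinite volumes need
   no special treatment. *)
Lemma brunn_minkowski n (A B C : set (n.-tuple R)) (l x y : R) : (0 < l < 1)%R ->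
  measurable A -> measurable B -> measurable C ->
  (forall a b, A a -> B b -> C (tcomb l a b)) ->
  (0 < x)%R -> (0 < y)%R ->
  (x ^+ n)%:E <= @lebesgue_n R n A -> (y ^+ n)%:E <= @lebesgue_n R n B ->
  (((1 - l) * x + l * y) ^+ n)%:E <= @lebesgue_n R n C.
Proof.
move=> l01; elim: n A B C x y => [|n IH] A B C x y mA mB mC ABC x0 y0.
  have ne0 (D : set (0.-tuple R)) : 1 <= @lebesgue_n R 0 D <-> D [tuple].
    rewrite /lebesgue_n/= indicE; case: (boolP (_ \in D)); rewrite ?inE/=.
      by move=> D0; split => // _; exact: lexx.
    by rewrite notin_setE => nD; split => //; rewrite lee_fin ler10.
  rewrite !expr0 !ne0 => A0 B0.
  suff : C (tcomb l [tuple] [tuple]) by rewrite (tuple0 (tcomb _ _ _)).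
  exact: ABC.
have ABCs t t' a b : slice A t a -> slice B t' b ->
    slice C ((1 - l) * t + l * t')%R (tcomb l a b).
  by move=> Aa Bb; rewrite /slice/= -tcomb_cons; exact: ABC.
rewrite !lebesgue_nS; have [n0|n0] := posnP n; last first.
  apply: brunn_minkowski_step => //; try exact: measurable_fun_slice.
  move=> s s' z w z0 w0; apply: IH => //; try exact: measurable_slice.
  exact: ABCs.
(* In dimension one the slices are points and a bound by [x ^+ 0] says nothing about lengths; the
   inequality on the real line is used instead. *)
subst n => {IH}.
pose line (D : set (1.-tuple R)) := [set s | slice D s [tuple]].
have mline D : measurable D -> measurable (line D).
  move=> mD; rewrite -[line D]setTI.
  apply: (@measurable_cons _ _ R R id 0 (fun=> [tuple])) => //.
have lineE D : measurable D -> \int[leb]_t @lebesgue_n R 0 (slice D t) = leb (line D).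
  move=> mD; transitivity (\int[leb]_t (\1_(line D) t)%:E); last first.
    by rewrite integral_indic ?setIT//; exact: mline.
  apply: eq_integral => t _; rewrite /lebesgue_n/= !indicE.
  by congr ((nat_of_bool _)%:R%:E); apply/idP/idP; rewrite !inE.
have ne D z : (0 < z)%R -> (z ^+ 1)%:E <= leb (line D) -> line D !=set0.
  move=> z0 zD; apply/set0P/negP => /eqP D0.
  by move: zD; rewrite D0 measure0 lee_fin expr1 leNgt z0.
rewrite !lineE// => xA yB; have /andP[l0 l1] := l01.
apply: le_trans (@brunn_minkowski_real R (line A) (line B) (line C) l l01 _ _ _ _ _ _).
- rewrite expr1 EFinD !EFinM -[x]expr1 -[y]expr1.
  by apply: leeD; apply: lee_wpmul2l => //; rewrite lee_fin ?subr_ge0 ltW.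
- exact: mline.
- exact: mline.
- exact: mline.
- exact: ne xA.
- exact: ne yB.
- move=> s s' As Bs; have := ABCs _ _ _ _ As Bs.
  by rewrite (tuple0 (tcomb _ _ _)).
Qed.


End brunn_minkowski_n.

(** * Chords of the exponential and growth of level volumes *)

Section chord.
Context {R : realType}.

(** The tangent at [b] is evaluated at [a] and [c] with weights [c - b] and [b - a], for which the
    linear terms cancel. *)
Lemma expR_convex3 (a b c : R) : a <= b <= c ->
  (c - a) * expR b <= (c - b) * expR a + (b - a) * expR c.
Proof.
move=> /andP[ab bc].
have tangent x : expR b * (1 + (x - b)) <= expR x.
  by rewrite -[leRHS](_ : expR b * expR (x - b) = _) ?ler_pM2l ?expR_gt0 ?expR_ge1Dx//
    -expRD; congr expR; ring.
have := lerD (ler_wpM2l (_ : 0 <= c - b) (tangent a)) (ler_wpM2l (_ : 0 <= b - a)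
  (tangent c)).
rewrite !subr_ge0 => /(_ bc ab); apply: le_trans.
by rewrite le_eqVlt; apply/orP; left; apply/eqP; ring.
Qed.

(** A convex function is below its chord between [y1] and [y2] and above it outside, opposite to the
    sign of [d]. At the two points themselves the first factor is zero, so [d] may have any sign
    there. *)
Lemma expR_chord (c y1 y2 : R) : y1 <= y2 -> exists A B : R, forall y d : R,
  (y < y1 -> d <= 0) -> (y1 < y < y2 -> 0 <= d) -> (y2 < y -> d <= 0) ->
  (expR (c * y) - (A + B * y)) * d <= 0.
Proof.
(* When the two points coincide the chord becomes the tangent. *)
rewrite le_eqVlt => /predU1P[<-|y12].
  exists (expR (c * y1) * (1 - c * y1)), (c * expR (c * y1)) => y d dl _ dr.
  have [yy1|yy1|->] := ltgtP y y1; last by rewrite [X in X * _](_ : _ = 0) ?mul0r//; ring.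
  - apply: mulr_ge0_le0; last exact: dl.
    rewrite [leRHS](_ : _ = expR (c * y) - expR (c * y1) * (1 + (c * y - c * y1)));
      last by ring.
    by rewrite subr_ge0 -[leRHS](_ : expR (c * y1) * expR (c * y - c * y1) = _)
      ?ler_pM2l ?expR_gt0 ?expR_ge1Dx//
      -expRD; congr expR; ring.
  - apply: mulr_ge0_le0; last exact: dr.
    rewrite [leRHS](_ : _ = expR (c * y) - expR (c * y1) * (1 + (c * y - c * y1)));
      last by ring.
    by rewrite subr_ge0 -[leRHS](_ : expR (c * y1) * expR (c * y - c * y1) = _)
      ?ler_pM2l ?expR_gt0 ?expR_ge1Dx//
      -expRD; congr expR; ring.
have y21 : 0 < y2 - y1 by rewrite subr_gt0.
have convex3 u v w : u <= v <= w ->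
    (w - u) * expR (c * v) <= (w - v) * expR (c * u) + (v - u) * expR (c * w).
  move=> /andP[uv vw]; have [c0|c0|->] := ltgtP c 0; last by rewrite !mul0r expR0; lra.
  - have : c * w <= c * v <= c * u by rewrite !ler_nM2l// vw uv.
    move=> /expR_convex3 => H; rewrite -(ler_nM2l c0) -subr_ge0; move: H; rewrite
      -subr_ge0.
    by congr (_ <= _); ring.
  - have : c * u <= c * v <= c * w by rewrite !ler_pM2l// vw uv.
    move=> /expR_convex3 => H; rewrite -(ler_pM2l c0) -subr_ge0; move: H; rewrite
      -subr_ge0.
    by congr (_ <= _); ring.
pose B := (expR (c * y2) - expR (c * y1)) / (y2 - y1).
exists (expR (c * y1) - B * y1), B => y d dl dm dr.
have gapE : (y2 - y1) * (expR (c * y) - (expR (c * y1) - B * y1 + B * y)) =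
    (y2 - y1) * expR (c * y) - ((y2 - y) * expR (c * y1) + (y - y1) * expR (c * y2)).
  by rewrite /B; field; rewrite gt_eqF.
rewrite -(pmulr_rle0 _ y21) mulrA gapE.
have [yy1|yy1|->] := ltgtP y y1; last by rewrite [X in X * _](_ : _ = 0) ?mul0r//; ring.
- apply: mulr_ge0_le0; last exact: dl.
  have : y <= y1 <= y2 by rewrite !ltW.
  by move=> /convex3; rewrite -subr_ge0; congr (_ <= _); ring.
- have [yy2|yy2|->] := ltgtP y y2; last by rewrite [X in X * _](_ : _ = 0) ?mul0r//; ring.
  + apply: mulr_le0_ge0; last by apply: dm; rewrite yy1 yy2.
    by rewrite subr_le0; apply: convex3; rewrite !ltW.
  + apply: mulr_ge0_le0; last exact: dr.
    have : y1 <= y2 <= y by rewrite !ltW.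
    by move=> /convex3; rewrite -subr_ge0; congr (_ <= _); ring.
Qed.

End chord.

(** * A priori bounds from concavity and a power bound *)

Section level_bounds.
Context {R : realType}.

(** To be applied to the [n]-th root of the level volume. If [v] were positive everywhere, concavity
    would give [v t >= t * v 1 / 2] on the unit interval, so [t ^+ n] would be bounded by a multiple
    of [powR t beta], which fails near 0. The second bound is the at most linear growth of a concave
    function. *)
Lemma level_bounds (n : nat) (beta : R) (v : R -> R) : (0 < n)%N -> n%:R < beta ->
  (forall t, 0 <= v t) -> (forall s t, 0 < s -> s <= t -> v s <= v t) ->
  (forall s t l, 0 < s -> 0 < t -> 0 < l < 1 -> 0 < v s -> 0 < v t ->
     (1 - l) * v s + l * v t <= v ((1 - l) * s + l * t)) ->
  (forall t, 0 < t -> v t ^+ n <= powR t beta) ->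
  (exists2 m, 0 < m & v m = 0) /\
  (forall m, 0 < m -> exists C, forall t, m <= t -> v t ^+ n <= C * t ^+ n).
Proof.
move=> n0 nbeta v0 vnd vconc vpow; split.
  apply: contrapT => noM.
  have vpos t : 0 < t -> 0 < v t.
    by move=> t0; rewrite lt_neqAle v0 andbT; apply/eqP => vt; apply: noM; exists t.
  pose c := (v 1 / 2) ^+ n.
  have c0 : 0 < c by rewrite exprn_gt0// divr_gt0// vpos.
  have cle t : 0 < t -> t < 1 -> c <= powR t (beta - n%:R).
    move=> t0 t1.
    have vt : t * (v 1 / 2) <= v t.
      (* The weight that writes [t] as a combination of [t / 2] and 1; the term at [t / 2] is then
         dropped. *)
      pose l := (t / 2) / (1 - t / 2).
      have d0 : 0 < 1 - t / 2 by lra.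
      have l0 : 0 < l by rewrite divr_gt0// divr_gt0.
      have l1 : l < 1 by rewrite ltr_pdivrMr//; lra.
      have := vconc (t / 2) 1 l; rewrite l0 l1 divr_gt0// ltr01.
      move=> /(_ isT isT isT (vpos _ _) (vpos _ _)); rewrite divr_gt0// ltr01.
      move=> /(_ isT isT).
      have -> : (1 - l) * (t / 2) + l * 1 = t by rewrite /l; field; rewrite gt_eqF//; lra.
      apply: le_trans; apply: (@le_trans _ _ (l * v 1)).
        rewrite mulrCA mulrC ler_wpM2r// /l ler_pdivlMr//.
        have := v0 1; nra.
      by rewrite lerDr mulr_ge0// subr_ge0 ltW.
    have : (t * (v 1 / 2)) ^+ n <= powR t beta.
      by apply: le_trans (vpow t t0); rewrite ler_pXn2r// ?nnegrE ?mulr_ge0 ?divr_ge0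
        // ltW.
    have -> : powR t (beta - n%:R) = powR t beta / t ^+ n.
      by rewrite powRB ?gt_eqF ?implybT// powR_mulrn// ltW.
    by rewrite ler_pdivlMr ?exprn_gt0// exprMn mulrC.
  (* At the point [t] below 1 with [powR t (beta - n%:R) = e < c], the lower bound [cle] is
     violated. *)
  pose e := Num.min c 1 / 2.
  have e0 : 0 < e by rewrite divr_gt0// lt_min c0 ltr01.
  have e1 : e < 1.
    by rewrite /e ltr_pdivrMr// mul1r (@le_lt_trans _ _ 1) ?ge_min ?lexx ?orbT// ltr1n.
  have ec : e < c.
    rewrite /e ltr_pdivrMr//; apply: (@le_lt_trans _ _ c); first by rewrite ge_min lexx.
    by rewrite ltr_pMr// ltr1n.
  have bn0 : 0 < beta - n%:R by rewrite subr_gt0.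
  have ibn0 : 0 < (beta - n%:R)^-1 by rewrite invr_gt0.
  have t1 : powR e (beta - n%:R)^-1 < 1.
    rewrite -[ltRHS](_ : powR 1 (beta - n%:R)^-1 = 1); last by rewrite powR1.
    by apply: (gt0_ltr_powR ibn0) => //; rewrite nnegrE ltW.
  have ce : c <= e.
    have := cle (powR e (beta - n%:R)^-1) (powR_gt0 _ e0) t1.
    by rewrite -powRrM mulVf ?gt_eqF// powRr1// ltW.
  by move: (le_lt_trans ce ec); rewrite ltxx.
move=> m m0.
have [[t0 t00 vt0]|novt] := pselect (exists2 t, 0 < t & 0 < v t); last first.
  exists 0 => t mt; rewrite mul0r.
  have -> : v t = 0.
    apply/eqP; rewrite eq_le v0 andbT leNgt; apply/negP => vt.
    by apply: novt; exists t => //; exact: lt_le_trans mt.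
  by rewrite expr0n gtn_eqF.
pose t1 := 2 * t0.
have vt1 : 0 < v t1 by apply: lt_le_trans vt0 _; apply: vnd => //; rewrite /t1; lra.
(* The second summand serves [m <= t <= t1], by monotonicity; the first serves [t > t1], by
   concavity. *)
exists ((v t1 / t0 + v t1 / m) ^+ n) => t mt.
have tt0 : 0 < t by exact: lt_le_trans mt.
rewrite -exprMn ler_pXn2r// ?nnegrE//; last first.
  by rewrite mulr_ge0 ?addr_ge0 ?divr_ge0 ?ltW.
rewrite mulrDl; have [tt1|tt1] := leP t t1.
  apply: (le_trans (vnd _ _ tt0 tt1)); rewrite -[leLHS]add0r lerD//.
    by rewrite mulr_ge0 ?divr_ge0 ?ltW.
  by rewrite mulrAC ler_pdivlMr// ler_wpM2l// ltW.
rewrite -[leLHS]addr0 lerD//; last by rewrite mulr_ge0 ?divr_ge0 ?ltW.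
have [vt|vt] := ltP 0 (v t); last first.
  by apply: (le_trans vt); rewrite mulr_ge0 ?divr_ge0 ?ltW.
have t0t : 0 < t - t0 by rewrite /t1 in tt1; lra.
(* The weight for which the combination of [t0] and [t] is [t1 = 2 * t0], so that
   [l * v t <= v t1]. *)
pose l := t0 / (t - t0).
have l0 : 0 < l by rewrite divr_gt0.
have l1 : l < 1 by rewrite ltr_pdivrMr// /t1 in tt1 *; lra.
have := vconc t0 t l t00 tt0 _ vt0 vt; rewrite l0 l1 => /(_ isT).
have -> : (1 - l) * t0 + l * t = t1 by rewrite /l /t1; field; rewrite gt_eqF.
move=> H.
have {H} : l * v t <= v t1.
  by apply: le_trans H; rewrite lerDr mulr_ge0 ?ltW// subr_gt0.
rewrite -ler_pdivlMl// => /le_trans; apply.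
rewrite /l invf_div (_ : _ * v t1 = v t1 / t0 * (t - t0)); last by ring.
by rewrite ler_wpM2l ?divr_ge0 ?ltW// ltrBlDr ltrDl.
Qed.

End level_bounds.

(** * Comparison of functions crossing at most twice *)

Section crossing.
Context {R : realType}.
Local Notation leb := (@lebesgue_measure R).

Section crossing_comparison.
Variables (m c : R) (w d : R -> R).
Hypothesis m0 : 0 < m.
Let E : set R := `[m, +oo[%classic.
Hypothesis w0 : forall t, m <= t -> 0 < w t.
Hypothesis i0 : leb.-integrable E (fun t => (w t * d t)%:E).
Hypothesis i1 : leb.-integrable E (fun t => (w t * ln t * d t)%:E).
Hypothesis ic : leb.-integrable E (fun t => (w t * expR (c * ln t) * d t)%:E).
Hypothesis z0 : (\int[leb]_(t in E) (w t * d t)%:E = 0)%E.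
Hypothesis z1 : (\int[leb]_(t in E) (w t * ln t * d t)%:E = 0)%E.
Hypothesis dconvex : forall s t r, m <= s -> s < t -> t < r ->
  0 < d s -> 0 < d r -> 0 < d t.

Let mE : @measurable _ (measurableTypeR R) E. Proof. exact: measurable_itv. Qed.

Let affine_integrable A B :
  leb.-integrable E (fun t => (w t * (A + B * ln t) * d t)%:E).
Proof.
have := integrableD mE (integrableZl mE A i0) (integrableZl mE B i1).
apply: eq_integrable => //.
by move=> t _ /=; rewrite -!EFinM -EFinD; congr EFin; ring.
Qed.

Let integral_affine A B : (\int[leb]_(t in E) (w t * (A + B * ln t) * d t)%:E = 0)%E.
Proof.
transitivity (\int[leb]_(t in E) (A%:E * (w t * d t)%:E + B%:E * (w t * ln t * d
  t)%:E))%E.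
  by apply: eq_integral => t _ /=; rewrite -!EFinM -EFinD; congr EFin; ring.
rewrite integralD//=; [|exact: integrableZl|exact: integrableZl].
by rewrite !integralZl// z0 z1 !mule0 adde0.
Qed.

Let integral_chord A B :
  (\int[leb]_(t in E) (w t * (expR (c * ln t) - (A + B * ln t)) * d t)%:E =
   \int[leb]_(t in E) (w t * expR (c * ln t) * d t)%:E)%E.
Proof.
transitivity (\int[leb]_(t in E) ((w t * expR (c * ln t) * d t)%:E -
    (w t * (A + B * ln t) * d t)%:E))%E.
  by apply: eq_integral => t _ /=; rewrite -EFinB; congr EFin; ring.
by rewrite (integralB mE ic (affine_integrable A B)) integral_affine sube0.
Qed.

Let le0_integral_chord A B :
  (forall t, m <= t -> (expR (c * ln t) - (A + B * ln t)) * d t <= 0) ->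
  (\int[leb]_(t in E) (w t * expR (c * ln t) * d t)%:E <= 0)%E.
Proof.
move=> H; rewrite -(integral_chord A B) -(integral0 leb E).
apply: le_integral => //.
- have := integrableB mE ic (affine_integrable A B).
  apply: eq_integrable => //.
  by move=> t _ /=; rewrite -EFinB; congr EFin; ring.
- exact: integrable0.
- move=> t; rewrite inE /E/= in_itv/= andbT => mt; rewrite lee_fin -mulrA.
  by rewrite mulr_ge0_le0 ?H// ltW// w0.
Qed.

(* If [d] changes sign only once, then [(ln t - ln t1) * d t] is nonnegative
   with integral zero, so [d] vanishes almost everywhere. *)
Let one_crossing t1 : 0 < t1 -> (forall t, m <= t -> t < t1 -> d t <= 0) ->
  (forall t, m <= t -> t1 < t -> 0 <= d t) ->
  (\int[leb]_(t in E) (w t * expR (c * ln t) * d t)%:E = 0)%E.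
Proof.
move=> t10 dl dr.
pose g t := w t * (- ln t1 + 1 * ln t) * d t.
have g0 t : m <= t -> 0 <= g t.
  move=> mt; have tpos : 0 < t by exact: lt_le_trans mt.
  rewrite /g -mulrA mulr_ge0 ?(ltW (w0 mt))// mul1r.
  have [tt1|tt1|->] := ltgtP t t1; last by rewrite addNr mul0r.
  - apply: mulr_le0; last exact: dl.
    by rewrite addrC subr_le0 ler_ln ?posrE// ltW.
  - apply: mulr_ge0; last exact: dr.
    by rewrite addrC subr_ge0 ler_ln ?posrE// ltW.
have mg := measurable_int leb (affine_integrable (- ln t1) 1).
have : (\int[leb]_(t in E) `|(g t)%:E| = 0)%E.
  rewrite -(integral_affine (- ln t1) 1); apply: eq_integral => t.
  by rewrite inE /E/= in_itv/= andbT => mt; rewrite /= ger0_norm// g0.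
move=> /(ae_eq_integral_abs leb mE mg) gae.
rewrite (@ae_eq_integral _ _ _ leb E (cst 0%E))// ?integral0//.
  exact: (measurable_int leb ic).
(* At [t1] the logarithmic factor is zero and gives no information on [d]; one point is
   negligible. *)
have t1ae : {ae leb, forall t : R, t <> t1}.
  exists [set t1]; split => //; first exact: lebesgue_measure_set1.
  by move=> t /= /contrapT.
near=> t => /[dup] Et.
rewrite /E/= in_itv/= andbT => mt.
have tpos : 0 < t by exact: lt_le_trans mt.
have /eqP : g t = 0.
  suff : (g t)%:E = 0%E by case.
  move: (Et); near: t; exact: gae.
have lnt : - ln t1 + 1 * ln t != 0.
  rewrite mul1r addrC subr_eq0; apply/eqP => /ln_inj; rewrite !posrE => /(_ tpos t10).
  by near: t.
rewrite /g !mulf_eq0 (negbTE lnt) gt_eqF ?w0//= => /eqP ->.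
by rewrite mulr0.
Unshelve. all: by end_near. Qed.

(** The chord is taken through the logarithms of [inf D] and [sup D], where [D] is the positivity
    set of [d]. If [D] is empty the integrand is already nonpositive. *)
Lemma crossing_comparison :
  (\int[leb]_(t in E) (w t * expR (c * ln t) * d t)%:E <= 0)%E.
Proof.
pose D := [set t | m <= t /\ 0 < d t].
have dle t : m <= t -> ~ D t -> d t <= 0.
  by move=> mt Dt; rewrite leNgt; apply/negP => dt; exact: Dt.
have [D0|/set0P D0] := eqVneq D set0.
  apply: (@le0_integral_chord 0 0) => t mt; rewrite mul0r addr0 subr0.
  by rewrite mulr_ge0_le0 ?expR_ge0// dle// D0.
have lbD : has_lbound D by exists m => t [].
pose t1 := inf D.
have mt1 : m <= t1 by apply: lb_le_inf => // t [].
have t10 : 0 < t1 by exact: lt_le_trans mt1.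
have dl t : m <= t -> t < t1 -> d t <= 0.
  move=> mt tt1; apply: dle => // Dt.
  by have := ge_inf lbD Dt; rewrite leNgt tt1.
(* If [D] is unbounded there is no right end for a chord; [d] then changes sign only once, and the
   integral is zero. *)
have [ubD|nubD] := pselect (has_ubound D); last first.
  rewrite (@one_crossing t1)// => t mt t1t.
  have [s [ms ds] st] := inf_lt D0 t1t.
  have [r [mr dr] tr] : exists2 r, D r & t < r.
    apply: contrapT => /forall2NP H; apply: nubD; exists t => r Dr.
    by have [//|/negP] := H r; rewrite -leNgt.
  by rewrite ltW// (dconvex ms st tr).
pose t2 := sup D.
have [t0 Dt0] := D0.
have t12 : t1 <= t2 by exact: le_trans (ge_inf lbD Dt0) (ub_le_sup ubD Dt0).
have t20 : 0 < t2 by exact: lt_le_trans t12.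
have lnt12 : ln t1 <= ln t2 by rewrite ler_ln.
have [A [B chord]] := @expR_chord R c (ln t1) (ln t2) lnt12.
apply: (@le0_integral_chord A B) => t mt.
have tpos : 0 < t by exact: lt_le_trans mt.
apply: chord.
- by rewrite ltr_ln ?posrE//; exact: dl.
- rewrite !ltr_ln ?posrE// => /andP[t1t tt2].
  have [s [ms ds] st] := inf_lt D0 t1t.
  have [r [mr dr] tr] := sup_gt D0 tt2.
  by rewrite ltW// (dconvex ms st tr).
- rewrite ltr_ln ?posrE// => t2t; apply: dle => // Dt.
  by have := ub_le_sup ubD Dt; rewrite leNgt t2t.
Qed.

End crossing_comparison.
End crossing.

(** * Integrals of powers and logarithms on half-lines *)

Section power_log_integrals.
Context {R : realType}.
Local Notation leb := (@lebesgue_measure R).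

Lemma cvgr_ln : (@ln R x) @[x --> +oo] --> +oo.
Proof.
apply/cvgryPge => A; near=> x.
have xA : expR A <= x by near: x; exact: nbhs_pinfty_ge.
by rewrite -[leLHS]expRK ler_ln ?posrE ?expR_gt0// (lt_le_trans _ xA) ?expR_gt0.
Unshelve. all: by end_near. Qed.

(** Half of the exponential decay absorbs the affine factor, leaving the bound [C]; the other half
    tends to 0. *)
Lemma cvgr_expR_affine (k p K : R) : 0 < k ->
  (expR (- k * u) * (p * u + K)) @[u --> +oo] --> 0.
Proof.
move=> k0; pose C := `|p| * (2 / k) + `|K|.
have h0 : (C * expR (- (k / 2 * u))) @[u --> +oo] --> 0.
  rewrite -[X in _ --> X](mulr0 C); apply: cvgMr.
  apply: (@cvg_comp _ _ _ (fun u => k / 2 * u) (fun x => expR (- x)) _ +oo); last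
    exact: cvgr_expR.
  apply/cvgryPge => A; near=> u.
  by rewrite -ler_pdivrMl ?divr_gt0//; near: u; exact: nbhs_pinfty_ge.
apply/cvgr0Pnorm_le => e e0; near=> u.
have u0 : 0 <= u by near: u; exact: nbhs_pinfty_ge.
apply: (@le_trans _ _ (C * expR (- (k / 2 * u)))); last first.
  apply: le_trans (ler_norm _) _; near: u.
  by move/cvgr0Pnorm_le : h0; exact.
rewrite (_ : - k * u = - (k / 2 * u) + - (k / 2 * u)); last by field.
rewrite expRD; set e1 := expR _.
have e10 : 0 < e1 by exact: expR_gt0.
have e11 : e1 <= 1 by rewrite -expR0 ler_expR oppr_le0 mulr_ge0// divr_ge0// ltW.
rewrite normrM (ger0_norm (mulr_ge0 (ltW e10) (ltW e10))) mulrAC ler_wpM2r ?(ltW e10)//.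
apply: (@le_trans _ _ (e1 * (`|p| * u + `|K|))).
  rewrite ler_wpM2l ?(ltW e10)//; apply: (le_trans (ler_normD _ _)).
  by rewrite normrM (ger0_norm u0).
rewrite /C mulrDr lerD//; last by rewrite ler_piMl.
rewrite mulrCA ler_wpM2l// /e1 expRN ler_pdivrMl ?expR_gt0//.
have := expR_ge1Dx (k / 2 * u).
rewrite -(ler_pM2r (_ : 0 < 2 / k)) ?divr_gt0//; apply: le_trans.
rewrite (_ : (1 + k / 2 * u) * (2 / k) = u + 2 / k); last by field; rewrite gt_eqF.
by rewrite lerDl divr_ge0// ltW.
Unshelve. all: by end_near. Qed.

Lemma ge0_integral_itvcy_derive (f F : R -> R) (a l : R) :
  (forall t, a <= t -> 0 <= f t) -> (forall t, a <= t -> {for t, continuous f}) ->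
  (forall t, a <= t -> is_derive t 1 F (f t)) -> F t @[t --> +oo] --> l ->
  (\int[leb]_(t in `[a, +oo[) (f t)%:E = (l - F a)%:E)%E.
Proof.
move=> f0 cf dF Fl; rewrite (@ge0_continuous_FTC2y R f F a l) ?EFinB//.
- apply/continuous_within_itvcyP; split.
    by move=> x; rewrite in_itv/= andbT => /ltW/cf.
  by apply: cvg_at_right_filter; exact: cf.
- by move=> x /ltW/dF dFx; exact: ex_derive.
- apply: cvg_at_right_filter; apply: differentiable_continuous.
  by apply/derivable1_diffP; have dFx := dF a (lexx a); exact: ex_derive.
- move=> x; rewrite in_itv/= andbT => /ltW/dF dFx.
  by rewrite derive1E; exact: derive_val.
Qed.

(** The shape [p * ln + S] is stable under integration: [S] only gains [p / (r - 1)]. The case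
    [b = 0] gives the layer cake kernels, and [a = 0] integrates out one coordinate of a Pareto
    density. The scale [c] allows the integrand to be nonnegative. *)
Lemma integral_powR_ln (b c a r p S : R) : 0 < b + a -> 0 < c -> 1 < r ->
  (forall t, a <= t -> 0 <= p * ln ((b + t) / c) + S) ->
  (\int[leb]_(t in `[a, +oo[) (powR (b + t) (- r) * (p * ln ((b + t) / c) + S))%:E =
   (powR (b + a) (1 - r) / (r - 1) * (p * ln ((b + a) / c) + S + p / (r - 1)))%:E)%E.
Proof.
move=> ba0 c0 r1 f0.
have r10 : 0 < r - 1 by rewrite subr_gt0.
pose u t := ln (b + t).
pose f t := expR (- r * u t) * (p * u t + (S - p * ln c)).
pose K := S - p * ln c + p / (r - 1).
(* Antiderivative by parts in the variable [u = ln (b + t)]; the term [p / (r - 1)] in [K] offsets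
   the derivative of the logarithm. *)
pose F t := - (r - 1)^-1 * (expR (- (r - 1) * u t) * (p * u t + K)).
have bt0 t : a <= t -> 0 < b + t by move=> at'; apply: lt_le_trans ba0 _; rewrite lerD2l.
have fE t : a <= t -> powR (b + t) (- r) * (p * ln ((b + t) / c) + S) = f t.
  move=> /bt0 bt; rewrite /f /u /powR gt_eqF// ln_div ?posrE//; congr (_ * _); ring.
have du t : a <= t -> is_derive t 1 u (b + t)^-1.
  move=> /bt0 bt; have dln := is_derive1_ln bt.
  have dbt : is_derive t 1 (fun t : R => b + t) 1.
    by have := is_deriveD (is_derive_cst b t 1) (is_derive_id t 1); rewrite add0r.
  by have := @is_derive1_comp R (@ln R) (fun t : R => b + t) t _ _ dln dbt; rewrite mulr1.
transitivity (\int[leb]_(t in `[a, +oo[) (f t)%:E)%E.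
  by apply: eq_integral => t; rewrite inE/= in_itv/= andbT => /fE ->.
apply: (etrans (@ge0_integral_itvcy_derive f F a 0 _ _ _ _)); last first.
- congr EFin; rewrite /F /K /powR gt_eqF// ln_div ?posrE// -/(u a).
  by rewrite (_ : - (r - 1) = 1 - r); [field; rewrite gt_eqF|ring].
- rewrite -[X in _ --> X](mulr0 (- (r - 1)^-1)); apply: cvgMr.
  apply: (@cvg_comp _ _ _ u (fun x => expR (- (r - 1) * x) * (p * x + K)) _ +oo); last
    first.
    exact: cvgr_expR_affine.
  apply: (@cvg_comp _ _ _ (fun t => b + t) (@ln R) _ +oo); last exact: cvgr_ln.
  apply/cvgryPge => A; near=> x.
  by rewrite -lerBlDl; near: x; apply: nbhs_pinfty_ge; exact: num_real.
- move=> t at'; have dut := du t at'.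
  have dlin : is_derive t 1 (fun t => - (r - 1) * u t) (- (r - 1) * (b + t)^-1).
    by have := @is_deriveZ R R^o R^o u (- (r - 1)) t 1 _ dut.
  have dexp : is_derive t 1 (fun t => expR (- (r - 1) * u t))
      (expR (- (r - 1) * u t) * (- (r - 1) * (b + t)^-1)).
    exact: (@is_derive1_comp R (@expR R) (fun t => - (r - 1) * u t) t _ _ _ dlin).
  have dpu : is_derive t 1 (fun t => p * u t + K) (p * (b + t)^-1).
    have dpu' : is_derive t 1 (fun t => p * u t) (p * (b + t)^-1).
      by have := @is_deriveZ R R^o R^o u p t 1 _ dut.
    by have := @is_deriveD R R^o R^o (fun t => p * u t) (cst K) t 1 _ _ dpu'
      (is_derive_cst _ _ _); rewrite addr0.
  have dprod := @is_deriveM R R^o (fun t => expR (- (r - 1) * u t)) (fun t => p * u t +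
    K) t 1 _ _ dexp dpu.
  have := @is_deriveZ R R^o R^o _ (- (r - 1)^-1) t 1 _ dprod.
  move=> dF; apply: (is_derive_eq dF).
  rewrite /f /= /GRing.scale/=.
  have -> : expR (- r * u t) = expR (- (r - 1) * u t) * (b + t)^-1.
    rewrite -[X in _ * X^-1](@lnK R) ?posrE ?bt0// -expRN -expRD -/(u t); congr expR;
      ring.
  rewrite /K; field; rewrite !gt_eqF ?bt0//.
- move=> t at'; have dut := du t at'.
  have cu : {for t, continuous u}.
    by apply: differentiable_continuous; apply/derivable1_diffP; exact: ex_derive.
  apply: continuousM.
    apply: (continuous_comp _ (@continuous_expR R _)).
    by apply: continuousM => //; exact: cvg_cst.
  by apply: continuousD; [apply: continuousM => //|]; exact: cvg_cst.
- by move=> t at'; rewrite -fE// mulr_ge0 ?powR_ge0// f0.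
Unshelve. all: by end_near. Qed.

End power_log_integrals.

(** * Layer cake formula for level volumes *)

Section level_volume.
Context {R : realType}.
Local Notation leb := (@lebesgue_measure R).

Lemma measurable_set_ltr d (T : measurableType d) (f g : T -> R) :
  measurable_fun [set: T] f -> measurable_fun [set: T] g ->
  measurable [set x | f x < g x].
Proof.
move=> mf mg; rewrite -[X in measurable X]setTI.
under eq_set do rewrite -lte_fin.
by apply: measurable_lte => //; exact/measurable_EFinP.
Qed.

Lemma ltr_powRN (b x y : R) : 0 < b -> 0 < x -> 0 < y ->
  (powR x (- b) < powR y (- b)) = (y < x).
Proof.
move=> b0 x0 y0; rewrite !powRN ltf_pV2 ?posrE ?powR_gt0//.
apply/idP/idP; last by apply: gt0_ltr_powR => //; rewrite nnegrE ltW.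
rewrite !ltNge; apply: contra.
by apply: ge0_ler_powR; rewrite ?nnegrE ltW.
Qed.

Lemma powRNK (b x : R) : b != 0 -> 0 < x -> powR (powR x (- b^-1)) (- b) = x.
Proof. by move=> b0 x0; rewrite -powRrM mulrNN mulVf// powRr1// ltW. Qed.

Lemma ltr_powRN_swap (b t y : R) : 0 < b -> 0 < t -> 0 < y ->
  (powR t (- b) < y) = (powR y (- b^-1) < t).
Proof.
move=> b0 t0 y0; rewrite -[in LHS](@powRNK b y) ?gt_eqF//.
by rewrite ltr_powRN// powR_gt0.
Qed.

Variables (n : nat) (beta : R) (f : n.-tuple R -> R).
Hypothesis beta0 : 0 < beta.
Hypothesis mf : measurable_fun [set: n.-tuple R] f.
Hypothesis f0 : forall x, 0 <= f x.
Local Notation mu := (@lebesgue_n R n).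

(* The volume of [{phi < t}] for [phi = f^(-1/beta)]. *)
Definition level_volume (t : R) : \bar R := mu [set x | powR t (- beta) < f x].

Lemma measurable_level_set u : measurable [set x | u < f x].
Proof.
by apply: measurable_set_ltr => //; exact: measurable_cst.
Qed.

(** Tonelli on the set of pairs with [phi x < t], where [phi = f^(-1/beta)]: integrating [K] in [t]
    first leaves its tail integral [Theta] at [phi x]. Since [level_volume m = 0], almost every
    point of the support has [phi >= m], so starting at [m] loses nothing. *)
Lemma layer_cake (K Theta : R -> R) (h : n.-tuple R -> R) (m : R) : 0 < m ->
  measurable_fun [set: R] K -> (forall t, m <= t -> 0 <= K t) ->
  (forall s, m <= s -> (\int[leb]_(t in `[s, +oo[) (K t)%:E = (Theta s)%:E)%E) ->
  level_volume m = 0%E -> measurable_fun [set: n.-tuple R] h ->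
  (forall x, 0 < f x -> m <= powR (f x) (- beta^-1) ->
    h x = Theta (powR (f x) (- beta^-1))) ->
  (forall x, f x = 0 -> h x = 0) ->
  (\int[leb]_(t in `[m, +oo[) ((K t)%:E * level_volume t) = \int[mu]_x (h x)%:E)%E.
Proof.
move=> m0 mK K0 KTheta Vm mh hpos h0.
pose T2 := measurableTypeR R.
pose U : set (n.-tuple R * T2) := [set p | m <= p.2 /\ powR p.2 (- beta) < f p.1].
have mU : measurable U.
  rewrite (_ : U = (setT `*` `[m, +oo[%classic) `&`
    [set p | powR p.2 (- beta) < f p.1]); last first.
    apply/seteqP; split => -[x t] /=; rewrite /U/= in_itv/= andbT; tauto.
  apply: measurableI; first by apply: measurableX => //; exact: measurable_itv.
  apply: measurable_set_ltr.
    have mpow : measurable_fun [set: R] (fun t : R => powR t (- beta)) by exact: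
      measurable_powR.
    exact: (measurableT_comp mpow (@measurable_snd _ _ (n.-tuple R) T2)).
  exact: (measurableT_comp mf (@measurable_fst _ _ (n.-tuple R) T2)).
pose F (p : n.-tuple R * T2) : \bar R := ((K p.2)%:E * (\1_U p)%:E)%E.
have mF : measurable_fun [set: n.-tuple R * T2] F.
  apply: emeasurable_funM; apply/measurable_EFinP.
    exact: (measurableT_comp mK (@measurable_snd _ _ (n.-tuple R) T2)).
  exact: measurable_indic.
have F0 p : (0 <= F p)%E.
  rewrite /F indicE; case: (boolP (p \in U)) => [|_]; last by rewrite mule0.
  by rewrite inE => -[mp _]; rewrite mule1 lee_fin K0.
transitivity (\int[leb]_t \int[mu]_x F (x, t))%E.
  rewrite integral_mkcond; apply: eq_integral => t _.
  rewrite patchE; case: ifPn => [|tm].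
    rewrite inE/= in_itv/= andbT => mt.
    rewrite /F/= ge0_integralZl//; last 2 first.
    - apply/measurable_EFinP.
      exact: (measurableT_comp (measurable_indic mU) (@measurable_pair2 _ _ (n.-tuple
        R) T2 t)).
    - by rewrite lee_fin K0.
    congr (_ * _)%E; rewrite /level_volume.
    rewrite -[X in mu X]setIT -integral_indic//; last exact: measurable_level_set.
    apply: eq_integral => x _; rewrite !indicE; congr ((nat_of_bool _)%:R%:E).
    by apply/idP/idP; rewrite !inE /U/=; [move=> ?; split|move=> []].
  rewrite integral0_eq// => x _; rewrite /F indicE memNset ?mule0//.
  by move=> [/= mt _]; move/negP: tm; apply; rewrite inE/= in_itv/= mt.
rewrite -(fubini_tonelli (m1 := mu) (m2 := leb) F mF F0).
apply: ae_eq_integral => //.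
- exact: (@measurable_fun_fubini_tonelli_F _ _ _ _ _ leb F mF F0).
- exact/measurable_EFinP.
(* The exceptional set is where [phi < m], null by [Vm]. *)
exists [set x | powR m (- beta) < f x]; split => //; first exact: measurable_level_set.
move=> x /= H; apply: contrapT => /negP; rewrite -leNgt => fxm; apply: H => _.
have [fx0|fx0] := eqVneq (f x) 0.
  rewrite h0// integral0_eq// => t _; rewrite /F indicE memNset ?mule0//.
  by rewrite /U/= fx0 => -[_]; rewrite ltNge powR_ge0.
have fxpos : 0 < f x by rewrite lt_neqAle eq_sym fx0 f0.
have mphi : m <= powR (f x) (- beta^-1).
  by move: fxm; rewrite !leNgt ltr_powRN_swap.
rewrite hpos// -KTheta// -integral_itv_obnd_cbnd//; last first.
  by apply/measurable_EFinP; exact: measurable_funS mK.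
rewrite [RHS]integral_mkcond; apply: eq_integral => t _.
rewrite patchE /F/= indicE; case: ifPn.
  rewrite inE/= in_itv/= andbT => phit; rewrite mem_set ?mule1//.
  have mt : m <= t by exact: le_trans mphi (ltW phit).
  by split => //=; rewrite ltr_powRN_swap// (lt_le_trans m0).
move=> tphi; rewrite memNset ?mule0// => -[/= mt].
rewrite ltr_powRN_swap// ?(lt_le_trans m0)// => phit.
by move/negP: tphi; apply; rewrite inE/= in_itv/= phit.
Qed.

Lemma level_volume_ge0 t : (0 <= level_volume t)%E.
Proof. exact: measure_ge0. Qed.

Lemma level_volume_le s t : 0 < s -> s <= t -> (level_volume s <= level_volume t)%E.
Proof.
move=> s0; rewrite le_eqVlt => /predU1P[->//|st].
apply: le_measure; rewrite ?inE; [exact: measurable_level_set..|].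
move=> x /=; apply: lt_trans; rewrite ltr_powRN//; exact: lt_trans st.
Qed.

Lemma measurable_level_volume m : 0 < m ->
  measurable_fun (`[m, +oo[ : set (measurableTypeR R)) level_volume.
Proof.
move=> m0.
pose T2 := measurableTypeR R.
pose U : set (n.-tuple R * T2) := [set p | powR p.2 (- beta) < f p.1].
have mU : measurable U.
  apply: measurable_set_ltr.
    have mpow : measurable_fun [set: R] (fun t : R => powR t (- beta)) by exact:
      measurable_powR.
    exact: (measurableT_comp mpow (@measurable_snd _ _ (n.-tuple R) T2)).
  exact: (measurableT_comp mf (@measurable_fst _ _ (n.-tuple R) T2)).
apply: (@measurable_funS _ _ _ _ setT) => //.
have := @measurable_fun_ysection _ _ (n.-tuple R) T2 R mu U mU.
apply: eq_measurable_fun => t _; rewrite /level_volume/=; congr (mu _).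
by apply/seteqP; split => x /=; [move/ysectionP|move=> ?; apply/ysectionP].
Qed.

Lemma level_volume_markov t : 0 < t -> (\int[mu]_x (f x)%:E = 1)%E ->
  (level_volume t <= (powR t beta)%:E)%E.
Proof.
move=> t0 f1; have tb : 0 < powR t (- beta) by exact: powR_gt0.
rewrite -[leRHS]mul1e -f1 -[powR t beta]opprK.
rewrite (_ : powR t beta = (powR t (- beta))^-1); last by rewrite powRN invrK.
rewrite opprK lee_pdivlMr// muleC /level_volume.
rewrite -[X in mu X]setIT -integral_indic//; last exact: measurable_level_set.
rewrite -ge0_integralZl//; last 2 first.
- by apply/measurable_EFinP; apply: measurable_indic; exact: measurable_level_set.
- by rewrite lee_fin ltW.
apply: ge0_le_integral => //.
- by move=> x _; rewrite mule_ge0// lee_fin// ltW.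
- apply: measurable_funeM; apply/measurable_EFinP; apply: measurable_indic.
  exact: measurable_level_set.
- exact/measurable_EFinP.
- move=> x _; rewrite -EFinM lee_fin indicE.
  case: (boolP (x \in _)) => [|_]; last by rewrite mulr0.
  by rewrite inE/= mulr1 => /ltW.
Qed.

Lemma level_volume_concave (s t l x y : R) : neg_inv_concave beta f ->
  0 < s -> 0 < t -> 0 < l < 1 -> 0 < x -> 0 < y ->
  ((x ^+ n)%:E <= level_volume s)%E -> ((y ^+ n)%:E <= level_volume t)%E ->
  ((((1 - l) * x + l * y) ^+ n)%:E <= level_volume ((1 - l) * s + l * t))%E.
Proof.
move=> fconc s0 t0 l01 x0 y0; have /andP[l0 l1] := l01.
have l10 : 0 < 1 - l by rewrite subr_gt0.
apply: brunn_minkowski => //; try exact: measurable_level_set.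
move=> a b /= fa fb.
have fa0 : 0 < f a by exact: le_lt_trans (powR_ge0 _ _) fa.
have fb0 : 0 < f b by exact: le_lt_trans (powR_ge0 _ _) fb.
have l01' : 0 <= l <= 1 by rewrite (ltW l0) (ltW l1).
apply: lt_le_trans (fconc a b l (mulr_gt0 fa0 fb0) l01'); rewrite ltr_powRN// ?addr_gt0
  ?mulr_gt0 ?powR_gt0//.
by rewrite ltrD// ltr_pM2l// -ltr_powRN_swap.
Qed.

End level_volume.

(** * Pareto integrals and simplex volumes *)

Section pareto_integrals.
Context {R : realType}.
Local Notation leb := (@lebesgue_measure R).

Definition positive_tuple n (x : n.-tuple R) : bool := [forall i, 0 < tnth x i].

Definition tuple_sum n (x : n.-tuple R) : R := \sum_(i < n) tnth x i.

Lemma positive_tuple_cons n (t : R) (x : n.-tuple R) :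
  positive_tuple [tuple of t :: x] = (0 < t) && positive_tuple x.
Proof.
apply/forallP/andP => [H|[t0 /forallP H] i].
  split; first by have := H ord0; rewrite (tnth_nth 0).
  by apply/forallP => i; have := H (lift ord0 i); rewrite tnthS.
have [->|i0] := eqVneq i ord0; first by rewrite (tnth_nth 0).
by case: (unliftP ord0 i) i0 => [j ->|->]; rewrite ?eqxx// tnthS.
Qed.

Lemma tuple_sum_cons n (t : R) (x : n.-tuple R) :
  tuple_sum [tuple of t :: x] = t + tuple_sum x.
Proof.
rewrite /tuple_sum big_ord_recl (tnth_nth 0)/=; congr (_ + _).
by apply: eq_bigr => i _; rewrite tnthS.
Qed.

Lemma tuple_sum_ge0 n (x : n.-tuple R) : positive_tuple x -> 0 <= tuple_sum x.
Proof. by move=> /forallP x0; apply: sumr_ge0 => i _; exact: ltW. Qed.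

Lemma measurable_tuple_sum n : measurable_fun [set: n.-tuple R] (@tuple_sum n).
Proof. by apply: measurable_sum => i; exact: measurable_tnth. Qed.

Lemma measurable_positive_tuple n : measurable_fun [set: n.-tuple R] (@positive_tuple n).
Proof.
apply: (measurable_fun_bool true) => //; rewrite setTI.
rewrite (_ : _ @^-1` _ = \bigcap_(i in [set: 'I_n]) [set x : n.-tuple R | 0 < tnth x i]).
  apply: fin_bigcap_measurable => // i _; apply: measurable_set_ltr => //.
  exact: measurable_tnth.
apply/seteqP; split => x /=.
  by move=> /forallP H i _; exact: H.
by move=> H; apply/forallP => i; exact: H.
Qed.

(** One family for two integrands: [p = 0], [S = 1] is the unnormalized Pareto density, and
    [p = beta], [c = b] carries the logarithm in its entropy. Fixing the first coordinate only
    shifts [b]. *)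
Definition pareto_ln n (b q c p S : R) (x : n.-tuple R) : R :=
  if positive_tuple x then
    powR (b + tuple_sum x) (- q) * (p * ln ((b + tuple_sum x) / c) + S)
  else 0.

Lemma measurable_ln_div (c : R) : measurable_fun [set: R] (fun u : R => ln (u / c)).
Proof. by apply: (measurableT_comp (@measurable_ln R)); exact: measurable_funM. Qed.

Lemma measurable_pareto_ln n b q c p S :
  measurable_fun [set: n.-tuple R] (@pareto_ln n b q c p S).
Proof.
apply: measurable_fun_ifT; [exact: measurable_positive_tuple| |exact: measurable_cst].
have mu : measurable_fun [set: n.-tuple R] (fun x => b + tuple_sum x).
  by apply: measurable_funD => //; exact: measurable_tuple_sum.
have mg : measurable_fun [set: R] (fun u : R => powR u (- q) * (p * ln (u / c) + S)).
  apply: measurable_funM; first exact: measurable_powR.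
  apply: measurable_funD => //; apply: measurable_funM => //.
  exact: measurable_ln_div.
exact: (measurableT_comp mg mu).
Qed.

Lemma ln_div_mono (b b' c p S : R) : 0 < b -> b <= b' -> 0 < c -> 0 <= p ->
  0 <= p * ln (b / c) + S -> 0 <= p * ln (b' / c) + S.
Proof.
move=> b0 bb' c0 p0; move/le_trans; apply; rewrite lerD2r ler_wpM2l//.
have b'0 : 0 < b' by exact: lt_le_trans bb'.
by rewrite ler_ln ?posrE ?divr_gt0// ler_pM2r// invr_gt0.
Qed.

Lemma pareto_ln_ge0 n b q c p S (x : n.-tuple R) : 0 < b -> 0 < c -> 0 <= p ->
  0 <= p * ln (b / c) + S -> 0 <= pareto_ln b q c p S x.
Proof.
move=> b0 c0 p0 H; rewrite /pareto_ln; case: ifPn => // x0.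
rewrite mulr_ge0 ?powR_ge0//; apply: (ln_div_mono b0) => //.
by rewrite lerDl tuple_sum_ge0.
Qed.

Lemma pareto_ln_cons n b q c p S t (x : n.-tuple R) :
  pareto_ln b q c p S [tuple of t :: x] =
  if 0 < t then pareto_ln (b + t) q c p S x else 0.
Proof.
rewrite /pareto_ln positive_tuple_cons tuple_sum_cons addrA.
by case: (0 < t); case: positive_tuple.
Qed.

(** Each coordinate lowers the exponent by one, contributes a factor [(q - i%:R)^-1] and adds
    [p * (q - i%:R)^-1] to the constant. *)
Lemma integral_pareto_ln n b q c p S : 0 < b -> 0 < c -> 0 <= p -> n%:R < q ->
  0 <= p * ln (b / c) + S ->
  (\int[@lebesgue_n R n]_x (pareto_ln b q c p S x)%:E =
   (powR b (n%:R - q) / \prod_(1 <= i < n.+1) (q - i%:R) *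
    (p * ln (b / c) + S + p * \sum_(1 <= i < n.+1) (q - i%:R)^-1))%:E)%E.
Proof.
elim: n b => [|n IH] b b0 c0 p0 nq H.
  rewrite integral_lebesgue_0 /pareto_ln /tuple_sum big_ord0.
  rewrite (_ : positive_tuple _ = true); last by apply/forallP => -[].
  by rewrite !big_geq// mulr0 !addr0 divr1 sub0r.
have nq' : n%:R < q by rewrite (lt_trans _ nq)// ltr_nat.
rewrite ge0_integral_lebesgue_nS; last 2 first.
- by apply/measurable_EFinP; exact: measurable_pareto_ln.
- by move=> x; rewrite lee_fin pareto_ln_ge0.
pose P := \prod_(1 <= i < n.+1) (q - i%:R).
pose T := \sum_(1 <= i < n.+1) (q - i%:R)^-1.
have P0 : 0 < P.
  rewrite /P big_seq prodr_gt0// => i; rewrite mem_index_iota => /andP[_ ilt].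
  by rewrite subr_gt0 (le_lt_trans _ nq')// ler_nat.
have T0 : 0 <= T.
  rewrite /T big_seq sumr_ge0// => i; rewrite mem_index_iota => /andP[_ ilt].
  by rewrite invr_ge0 subr_ge0 ltW// (le_lt_trans _ nq')// ler_nat.
pose k t : R := powR (b + t) (- (q - n%:R)) * (p * ln ((b + t) / c) + (S + p * T)).
have k0 t : 0 <= t -> 0 <= p * ln ((b + t) / c) + (S + p * T).
  move=> t0; rewrite addrA addr_ge0 ?mulr_ge0//.
  by apply: (ln_div_mono b0) => //; rewrite lerDl.
have mk : measurable_fun [set: R] k.
  have mg : measurable_fun [set: R]
      (fun u : R => powR u (- (q - n%:R)) * (p * ln (u / c) + (S + p * T))).
    apply: measurable_funM; first exact: measurable_powR.
    apply: measurable_funD => //; apply: measurable_funM => //.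
    exact: measurable_ln_div.
  have mbt : measurable_fun [set: R] (fun t : R => b + t) by exact: measurable_funD.
  exact: (measurableT_comp mg mbt).
transitivity (\int[leb]_(t in `]0%R, +oo[) (P^-1%:E * (k t)%:E))%E.
  rewrite [RHS]integral_mkcond; apply: eq_integral => t _.
  rewrite patchE; case: ifPn; last first.
    move=> tE; rewrite integral0_eq// => x _; rewrite pareto_ln_cons.
    by case: ifPn => // t0; move/negP: tE; case; rewrite inE/= in_itv/= t0.
  rewrite inE/= in_itv/= andbT => t0.
  under eq_integral do rewrite pareto_ln_cons t0.
  rewrite IH ?addr_gt0//; last by apply: (ln_div_mono b0) => //; rewrite lerDl ltW.
  by rewrite -EFinM -/P -/T /k opprB addrA; congr EFin; ring.
rewrite integral_itv_obnd_cbnd; last first.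
  apply: measurable_funeM; apply/measurable_EFinP.
  exact: (@measurable_funS _ _ (measurableTypeR R) R setT).
rewrite ge0_integralZl//; last 3 first.
- by apply/measurable_EFinP; exact: (@measurable_funS _ _ (measurableTypeR R) R setT).
- move=> t /=; rewrite in_itv/= andbT => t0.
  by rewrite lee_fin mulr_ge0 ?powR_ge0// k0.
- by rewrite lee_fin invr_ge0 ltW.
have q1 : 0 < q - n%:R - 1 by rewrite -addrA -opprD natr1 subr_gt0.
rewrite integral_powR_ln ?addr0//; last by rewrite -subr_gt0.
rewrite -EFinM [\prod_(1 <= i < n.+2) _]big_nat_recr//= [\sum_(1 <= i < n.+2)
  _]big_nat_recr//= -/P -/T.
have -> : 1 - (q - n%:R) = n.+1%:R - q by rewrite -natr1; ring.
have -> : q - n.+1%:R = q - n%:R - 1 by rewrite -natr1; ring.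
by congr EFin; field; rewrite !gt_eqF.
Qed.

Lemma integral_simplex_power n (r : R) : 0 < r ->
  (\int[leb]_(t in `[0%R, r]) ((r - t) ^+ n / n`!%:R)%:E = (r ^+ n.+1 / n.+1`!%:R)%:E)%E.
Proof.
move=> r0.
pose F (t : R) := - (n.+1`!%:R)^-1 * (r - t) ^+ n.+1.
have dF (t : R) : is_derive t 1 F ((r - t) ^+ n / n`!%:R).
  have dsub : is_derive t 1 (fun t : R => r - t) (-1).
    by have := @is_deriveB R R^o R^o (cst r) id t 1 _ _ (is_derive_cst r t 1)
      (is_derive_id t 1); rewrite sub0r.
  have dX := @is_deriveX R R^o (fun t : R => r - t) n.+1 t 1 _ dsub.
  rewrite exprfctE in dX.
  have dZ := @is_deriveZ R R^o R^o _ (- (n.+1`!%:R)^-1) t 1 _ dX.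
  apply: (is_derive_eq dZ); rewrite /= /GRing.scale/= factS natrM.
  by field; rewrite nat1r !pnatr_eq0 -lt0n fact_gt0.
have cF (t : R) : {for t, continuous F}.
  apply: differentiable_continuous; apply/derivable1_diffP.
  by have dFt := dF t; exact: ex_derive.
rewrite (@continuous_FTC2 R _ F 0 r)//.
- by rewrite -EFinB /F subrr subr0 expr0n mulr0 sub0r mulNr opprK mulrC.
- apply: continuous_subspaceT => t.
  have cs : {for t, continuous (fun t : R => r - t)}.
    by apply: cvgB; [exact: cvg_cst|exact: cvg_id].
  apply: cvgM; last exact: cvg_cst.
  exact: (continuous_comp cs (@exprn_continuous R n _)).
- split.
  + by move=> t _; have dFt := dF t; exact: ex_derive.
  + by apply: cvg_at_right_filter; exact: cF.
  + by apply: cvg_at_left_filter; exact: cF.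
- by move=> t _; rewrite derive1E; have dFt := dF t; exact: derive_val.
Qed.

Definition simplex n (r : R) : set (n.-tuple R) :=
  [set x | positive_tuple x /\ tuple_sum x < r].

Lemma simplex_volume n (r : R) :
  @lebesgue_n R n (@simplex n r) = (if 0 < r then r ^+ n / n`!%:R else 0)%:E.
Proof.
elim: n r => [|n IH] r.
  rewrite /lebesgue_n/= indicE.
  have -> : ([tuple] \in @simplex 0 r) = (0 < r).
    apply/idP/idP; rewrite inE /simplex /tuple_sum/= big_ord0; first by case.
    by move=> r0; split => //; apply/forallP => -[].
  by case: ifPn => //; rewrite expr0 divr1.
rewrite lebesgue_nS.
have sliceS t : slice (@simplex n.+1 r) t = if 0 < t then @simplex n (r - t) else set0.
  apply/seteqP; split => x; rewrite /slice /simplex/= positive_tuple_cons tuple_sum_cons.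
    by case: (0 < t) => /=; rewrite ?ltrBrDl// => -[].
  by case: (0 < t) => //=; rewrite ltrBrDl.
under eq_integral do rewrite sliceS.
case: ifPn => [r0|]; last first.
  rewrite -leNgt => r0; rewrite integral0_eq// => t _.
  case: ifPn => t0; last by rewrite measure0.
  rewrite IH; case: ifPn => //.
  by rewrite subr_gt0 => tr; move: (lt_trans t0 (lt_le_trans tr r0)); rewrite ltxx.
rewrite -integral_simplex_power//.
have mpow : measurable_fun [set: R] (fun t : R => ((r - t) ^+ n / n`!%:R)%:E).
  apply/measurable_EFinP; apply: measurable_funM => //.
  by apply: measurable_funX; exact: measurable_funB.
rewrite -integral_itv_obnd_cbnd; last exact: (@measurable_funS _ _ (measurableTypeR R)
  _ setT).
rewrite -integral_itv_bndo_bndc; last exact: (@measurable_funS _ _ (measurableTypeR R)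
  _ setT).
rewrite [RHS]integral_mkcond; apply: eq_integral => t _.
rewrite patchE; have [/andP[t0 tr]|tE] := boolP (0 < t < r).
  rewrite mem_set/= ?in_itv/= ?t0//.
  by rewrite IH subr_gt0 tr.
rewrite memNset/= ?in_itv/=; last exact/negP.
case: ifPn => t0; last by rewrite measure0.
by move: tE; rewrite t0 /= => /negbTE rt; rewrite IH subr_gt0 rt.
Qed.

End pareto_integrals.

(** * Moments of a density in terms of its level volumes *)

Section moments.
Context {R : realType}.
Local Notation leb := (@lebesgue_measure R).

Lemma integral_kernel (s c q p S : R) : 0 < s -> 0 < c -> 0 < q ->
  (forall t, s <= t -> 0 <= p * ln (t / c) + S) ->
  (\int[leb]_(t in `[s, +oo[) (powR t (- (q + 1)) * (p * ln (t / c) + S))%:E =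
   (powR s (- q) / q * (p * ln (s / c) + S + p / q))%:E)%E.
Proof.
move=> s0 c0 q0 H.
have := @integral_powR_ln R 0 c s (q + 1) p S; rewrite add0r addrK ltrDr.
have -> : 1 - (q + 1) = - q by ring.
move=> <- //; first by apply: eq_integral => t _; rewrite add0r.
by move=> t st; rewrite add0r H.
Qed.

Lemma measurable_kernel (c q p S : R) :
  measurable_fun [set: R] (fun t : R => powR t (- (q + 1)) * (p * ln (t / c) + S)).
Proof.
apply: measurable_funM; first exact: measurable_powR.
apply: measurable_funD => //; apply: measurable_funM => //.
by apply: (measurableT_comp (@measurable_ln R)); exact: measurable_funM.
Qed.

Lemma exp_momentE n (f : n.-tuple R -> R) (H alpha : R) :
  measurable_fun [set: n.-tuple R] f -> (forall x, 0 <= f x) ->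
  entropy f = H%:E -> alpha < 1 ->
  exp_moment f alpha =
  ((expR (- alpha * H))%:E * \int[@lebesgue_n R n]_x (powR (f x) (1 - alpha))%:E)%E.
Proof.
move=> mf f0 fH a1; rewrite /exp_moment fH -ge0_integralZl//.
- apply: eq_integral => x _; rewrite -EFinB -EFinM /= -!EFinM; congr EFin.
  (* Where [f] vanishes both sides are 0: the left by its factor [f x], the right because
     [1 - alpha] is nonzero. *)
  have [->|fx0] := eqVneq (f x) 0.
    by rewrite mul0r powR0 ?mulr0// gt_eqF// subr_gt0.
  rewrite [in RHS]/powR (negbTE fx0) -expRD -[X in X * _](@lnK R); last first.
    by rewrite posrE lt_neqAle eq_sym fx0 f0.
  by rewrite -expRD; congr expR; ring.
- apply/measurable_EFinP.
  exact: (measurableT_comp (measurable_powR (1 - alpha)) mf).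
- by move=> x _; rewrite lee_fin powR_ge0.
Qed.

(** * Densities whose level volume vanishes at [m] and is O(t^n) beyond *)

Section tame.
Variables (n : nat) (beta m C : R) (f : n.-tuple R -> R).
Local Notation mu := (@lebesgue_n R n).
Hypothesis nbeta : n%:R < beta.
Hypothesis fd : is_density f.
Hypothesis m0 : 0 < m.
Hypothesis Vm : level_volume beta f m = 0%E.
Hypothesis C0 : 0 <= C.
Hypothesis VC : forall t, m <= t -> (level_volume beta f t <= (C * t ^+ n)%:E)%E.

Let E : set R := `[m, +oo[%classic.
Let mE : @measurable _ (measurableTypeR R) E. Proof. exact: measurable_itv. Qed.
Let V t := fine (level_volume beta f t).
Let mf : measurable_fun [set: n.-tuple R] f. Proof. by case: fd. Qed.
Let f0 x : 0 <= f x. Proof. by case: fd => _ []. Qed.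
Let f1 : (\int[mu]_x (f x)%:E = 1)%E. Proof. by case: fd => _ []. Qed.
Let beta0 : 0 < beta. Proof. exact: le_lt_trans nbeta. Qed.

Let VE t : m <= t -> (V t)%:E = level_volume beta f t.
Proof.
move=> mt; rewrite /V fineK// ge0_fin_numE ?level_volume_ge0//.
by rewrite (le_lt_trans (VC mt))// ltry.
Qed.

Let Etm t : t \in E -> m <= t.
Proof. by rewrite inE /E/= in_itv/= andbT. Qed.

Let mV : measurable_fun (E : set (measurableTypeR R)) (level_volume beta f).
Proof. exact: measurable_level_volume. Qed.

Let onE (K : R -> R) : measurable_fun [set: R] K ->
  measurable_fun (E : set (measurableTypeR R)) K.
Proof. by move=> mK; exact: (@measurable_funS _ _ (measurableTypeR R) R setT). Qed.

Let level_integrable (K : R -> R) : measurable_fun [set: R] K ->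
  (forall t, m <= t -> 0 <= K t) ->
  (\int[leb]_(t in E) ((K t)%:E * level_volume beta f t) < +oo)%E ->
  leb.-integrable E (fun t => (K t * V t)%:E).
Proof.
move=> mK K0 Koo.
apply: (eq_integrable mE (fun t => ((K t)%:E * level_volume beta f t)%E)).
  by move=> t /Etm mt; rewrite -VE// EFinM.
apply/integrableP; split.
  apply: emeasurable_funM => //; apply/measurable_EFinP.
  exact: onE.
apply: le_lt_trans Koo; rewrite le_eqVlt; apply/orP; left; apply/eqP.
apply: eq_integral => t /Etm mt.
by rewrite gee0_abs// mule_ge0 ?level_volume_ge0// lee_fin K0.
Qed.

(** The kernel has tail integral [powR s (- q)], which at [s = phi x] is [powR (f x) (q / beta)].
    The bound [C * t ^+ n] and [q > n] make the integral finite. *)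
Lemma power_moment q : n%:R < q ->
  (\int[leb]_(t in E) ((powR t (- (q + 1)) * q)%:E * level_volume beta f t) =
   \int[mu]_x (powR (f x) (q / beta))%:E)%E /\
  (\int[leb]_(t in E) ((powR t (- (q + 1)) * q)%:E * level_volume beta f t) < +oo)%E.
Proof.
move=> nq; have q0 : 0 < q by exact: le_lt_trans nq.
have K0 t : m <= t -> 0 <= powR t (- (q + 1)) * q.
  by move=> _; rewrite mulr_ge0 ?powR_ge0 ?ltW.
have mK r : measurable_fun [set: R] (fun t : R => powR t (- (r + 1)) * q).
  by apply: measurable_funM => //; exact: measurable_powR.
split.
  apply: (@layer_cake R n beta f beta0 mf f0 _ (fun s => powR s (- q))) => //.
  - move=> s ms; have s0 : 0 < s by exact: lt_le_trans ms.
    have := @integral_kernel s 1 q 0 q s0 ltr01 q0.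
    rewrite !mul0r add0r addr0 divfK ?gt_eqF// => <-; last by move=> t _; rewrite mul0r
      add0r ltW.
    by apply: eq_integral => t _; rewrite mul0r add0r.
  - exact: (measurableT_comp (measurable_powR (q / beta)) mf).
  - move=> x fx _; rewrite -powRrM; congr powR; field; rewrite gt_eqF//.
  - by move=> x ->; rewrite powR0// gt_eqF// divr_gt0.
have qn0 : 0 < q - n%:R by rewrite subr_gt0.
apply: (@le_lt_trans _ _ (\int[leb]_(t in E) (powR t (- ((q - n%:R) + 1)) * (0 * ln (t
  / 1) + q * C))%:E)%E).
  apply: ge0_le_integral => //.
  - by move=> t /= tE; rewrite mule_ge0 ?level_volume_ge0// lee_fin K0// Etm// inE.
  - apply: emeasurable_funM => //; apply/measurable_EFinP.
    exact: (onE (mK q)).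
  - apply/measurable_EFinP; apply: onE.
    exact: measurable_kernel.
  - move=> t /mem_set /Etm mt; have t0 : 0 < t by exact: lt_le_trans mt.
    apply: (@le_trans _ _ ((powR t (- (q + 1)) * q)%:E * (C * t ^+ n)%:E)%E).
      by apply: lee_wpmul2l; [rewrite lee_fin K0|exact: VC].
    rewrite -EFinM lee_fin mul0r add0r -powR_mulrn ?(ltW t0)//.
    rewrite (_ : - (q - n%:R + 1) = - (q + 1) + n%:R); last by ring.
    have tn0 : t != 0 by rewrite gt_eqF.
    rewrite powRD ?tn0 ?implybT// le_eqVlt; apply/orP; left; apply/eqP; ring.
rewrite integral_kernel ?ltry// => t _.
by rewrite mul0r add0r mulr_ge0// ltW.
Qed.

(** For this scale [beta * ln (t / c) - 1] equals [beta * ln (t / m)], so the logarithmic kernel is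
    nonnegative from [m] on and the layer cake formula applies. *)
Let c := m * expR (- beta^-1).
Let c0 : 0 < c. Proof. by rewrite mulr_gt0 ?expR_gt0. Qed.

Let ln_c_ge0 t : m <= t -> 0 <= beta * ln (t / c) + (-1).
Proof.
move=> mt; have t0 : 0 < t by exact: lt_le_trans mt.
rewrite subr_ge0 -ler_pdivrMl// mulr1 -[leLHS]expRK ler_ln ?posrE ?expR_gt0 ?divr_gt0//.
rewrite ler_pdivlMr// /c mulrCA -expRD subrr expR0 mulr1//.
Qed.

Lemma log_moment : exists H : R, entropy f = H%:E /\
  (\int[leb]_(t in E) ((powR t (- (beta + 1)) * (beta * ln (t / c) + (-1)))%:E *
     level_volume beta f t) = (H / beta - ln c)%:E)%E.
Proof.
set K := fun t : R => powR t (- (beta + 1)) * (beta * ln (t / c) + (-1)).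
have mK : measurable_fun [set: R] K by exact: measurable_kernel.
have K0 t : m <= t -> 0 <= K t by move=> mt; rewrite mulr_ge0 ?powR_ge0// ln_c_ge0.
pose h x := f x * (- ln (f x) / beta - ln c).
pose Theta s := powR s (- beta) * ln (s / c).
have Theta0 s : m <= s -> 0 <= Theta s.
  move=> ms; rewrite mulr_ge0 ?powR_ge0//; have := ln_c_ge0 ms.
  by rewrite subr_ge0 -ler_pdivrMl// mulr1; apply: le_trans; rewrite invr_ge0 ltW.
have KTheta s : m <= s -> (\int[leb]_(t in `[s, +oo[) (K t)%:E = (Theta s)%:E)%E.
  move=> ms; have s0 : 0 < s by exact: lt_le_trans ms.
  rewrite integral_kernel//; last by move=> t st; rewrite ln_c_ge0// (le_trans ms).
  by congr EFin; rewrite /Theta; field; rewrite !gt_eqF.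
have mh : measurable_fun [set: n.-tuple R] h.
  apply: measurable_funM => //; apply: measurable_funB => //.
  apply: measurable_funM => //; apply: measurableT_comp => //.
  exact: (measurableT_comp (@measurable_ln R) mf).
have hTheta x : 0 < f x -> m <= powR (f x) (- beta^-1) ->
    h x = Theta (powR (f x) (- beta^-1)).
  move=> fx _; rewrite /h /Theta powRNK ?gt_eqF//; congr (_ * _).
  by rewrite ln_div ?posrE ?powR_gt0// ln_powR; ring.
have h0 x : f x = 0 -> h x = 0 by move=> fx; rewrite /h fx mul0r.
have intK := layer_cake beta0 mf f0 m0 mK K0 KTheta Vm mh hTheta h0.
have intKabs : (\int[leb]_(t in E) ((K t)%:E * level_volume beta f t) =
    \int[mu]_x `|(h x)%:E|)%E.
  apply: (@layer_cake R n beta f beta0 mf f0 K Theta (fun x => `|h x|)) => //.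
  - exact: measurableT_comp.
  - by move=> x fx mx; rewrite hTheta// ger0_norm// Theta0.
  - by move=> x /h0 ->; rewrite normr0.
have Koo : (\int[leb]_(t in E) ((K t)%:E * level_volume beta f t) < +oo)%E.
  (* [q] lies halfway between [n] and [beta]: the spare power [e] absorbs the logarithm, and [q > n]
     keeps the power moment finite. *)
  pose e := (beta - n%:R) / 2; pose q := beta - e.
  have e0 : 0 < e by rewrite divr_gt0 ?subr_gt0.
  have nq : n%:R < q by rewrite -subr_gt0 (_ : q - n%:R = e)// /q /e; field.
  have q0 : 0 < q by exact: le_lt_trans nq.
  pose D := beta / e * powR c (- e) / q.
  have D0 : 0 <= D by rewrite !mulr_ge0 ?invr_ge0 ?powR_ge0 ?ltW.
  apply: (@le_lt_trans _ _ (D%:E * \int[leb]_(t in E) ((powR t (- (q + 1)) * q)%:E *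
    level_volume beta f t))%E); last first.
    by rewrite lte_mul_pinfty ?lee_fin//; exact: (power_moment nq).2.
  have mKq : measurable_fun (E : set (measurableTypeR R)) (fun t => ((powR t (- (q +
    1)) * q)%:E * level_volume beta f t)%E).
    apply: emeasurable_funM => //; apply/measurable_EFinP.
    apply: onE.
    by apply: measurable_funM => //; exact: measurable_powR.
  have Kq0 t : E t -> (0 <= (powR t (- (q + 1)) * q)%:E * level_volume beta f t)%E.
    by move=> _; rewrite mule_ge0 ?level_volume_ge0// lee_fin mulr_ge0 ?powR_ge0 ?ltW.
  rewrite -ge0_integralZl//.
  apply: ge0_le_integral => //.
  - by move=> t /mem_set/Etm mt; rewrite mule_ge0 ?level_volume_ge0// lee_fin K0.
  - apply: emeasurable_funM => //; apply/measurable_EFinP.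
    exact: onE.
  - exact: measurable_funeM.
  - move=> t /mem_set/Etm mt; have t0 : 0 < t by exact: lt_le_trans mt.
    rewrite muleA; apply: lee_wpmul2r; first exact: level_volume_ge0.
    rewrite -EFinM lee_fin /K.
    have lnle : ln (t / c) <= e^-1 * (powR t e * powR c (- e)).
      rewrite ler_pdivlMl// -ln_powR; apply: (le_trans (ltW (ln_sublinear _))).
        by rewrite powR_gt0// divr_gt0.
      rewrite powRM ?invr_ge0 ?(ltW t0) ?(ltW c0)//.
      by rewrite [powR c^-1 e]/powR [powR c _]/powR invr_eq0 gt_eqF// lnV ?posrE//
        mulNr mulrN.
    apply: (@le_trans _ _ (powR t (- (beta + 1)) * (beta * (e^-1 * (powR t e * powR c
      (- e)))))).
      rewrite ler_wpM2l ?powR_ge0// (@le_trans _ _ (beta * ln (t / c)))//.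
        by rewrite lerBlDr lerDl.
      by rewrite ler_wpM2l// ltW.
    rewrite (_ : - (q + 1) = - (beta + 1) + e); last by rewrite /q; ring.
    have tn0 : t != 0 by rewrite gt_eqF.
    rewrite powRD ?tn0 ?implybT// /D le_eqVlt; apply/orP; left; apply/eqP.
    by field; rewrite !gt_eqF.
have inth : mu.-integrable setT (fun x => (h x)%:E).
  by apply/integrableP; split; [exact/measurable_EFinP|rewrite -intKabs].
have intf : mu.-integrable setT (fun x => (f x)%:E).
  apply/integrableP; split; first exact/measurable_EFinP.
  under eq_integral do rewrite gee0_abs ?lee_fin//.
  by rewrite f1 ltry.
have [J JE] : exists J : R, (\int[mu]_x (h x)%:E = J%:E)%E.
  by exists (fine (\int[mu]_x (h x)%:E)%E); rewrite fineK// integrable_fin_num.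
exists (beta * J + beta * ln c); split; last first.
  by rewrite intK JE; congr EFin; field; rewrite gt_eqF.
rewrite /entropy.
(* Solving the definition of [h] for [f * ln f]; this is an integrable combination, so the entropy
   is finite. *)
transitivity (- \int[mu]_x ((- beta)%:E * (h x)%:E + (- beta * ln c)%:E * (f x)%:E))%E.
  congr (- _)%E; apply: eq_integral => x _; rewrite -!EFinM -EFinD; congr EFin.
  by rewrite /h; field; rewrite gt_eqF.
rewrite integralD//; [|exact: integrableZl|exact: integrableZl].
rewrite !integralZl// JE f1 mule1 -EFinM -EFinD -EFinN; congr EFin; ring.
Qed.

(** The first two values depend only on [beta] and on the entropy, so they agree for two densities
    of equal entropy. The third is written relative to the weight [powR t (- (beta + 1))], the form
    used by [crossing_comparison]. *)
Lemma level_moments q : n%:R < q -> exists H : R,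
  [/\ entropy f = H%:E,
   leb.-integrable E (fun t => (powR t (- (beta + 1)) * V t)%:E) /\
     (\int[leb]_(t in E) (powR t (- (beta + 1)) * V t)%:E = (beta^-1)%:E)%E,
   leb.-integrable E (fun t => (powR t (- (beta + 1)) * ln t * V t)%:E) /\
     (\int[leb]_(t in E) (powR t (- (beta + 1)) * ln t * V t)%:E =
      ((H + 1) / beta ^+ 2)%:E)%E &
   leb.-integrable E (fun t => (powR t (- (beta + 1)) * expR ((beta - q) * ln t) * V
     t)%:E) /\
     (\int[leb]_(t in E) (powR t (- (beta + 1)) * expR ((beta - q) * ln t) * V t)%:E =
      q^-1%:E * \int[mu]_x (powR (f x) (q / beta))%:E)%E].
Proof.
move=> nq; have q0 : 0 < q by exact: le_lt_trans nq.
have [H [fH HL]] := log_moment; exists H.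
have pow r : n%:R < r ->
    leb.-integrable E (fun t => (powR t (- (r + 1)) * V t)%:E) /\
    (\int[leb]_(t in E) (powR t (- (r + 1)) * V t)%:E =
      r^-1%:E * \int[mu]_x (powR (f x) (r / beta))%:E)%E.
  move=> nr; have r0 : 0 < r by exact: le_lt_trans nr.
  have [Ir Ioo] := power_moment nr.
  have iK : leb.-integrable E (fun t => (powR t (- (r + 1)) * r * V t)%:E).
    apply: level_integrable => //.
      by apply: measurable_funM => //; exact: measurable_powR.
    by move=> t _; rewrite mulr_ge0 ?powR_ge0 ?ltW.
  have rE t : (powR t (- (r + 1)) * V t)%:E = (r^-1%:E * (powR t (- (r + 1)) * r * V
    t)%:E)%E.
    by rewrite -EFinM; congr EFin; field; rewrite gt_eqF.
  split; first by have := integrableZl mE r^-1 iK; apply: eq_integrable => // t _;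
    rewrite rE.
  under eq_integral do rewrite rE.
  rewrite integralZl// -Ir; congr (_ * _)%E.
  by apply: eq_integral => t /Etm mt; rewrite -VE// EFinM.
have [i0 I0] := pow beta nbeta.
have {}I0 : (\int[leb]_(t in E) (powR t (- (beta + 1)) * V t)%:E = (beta^-1)%:E)%E.
  rewrite I0 divff ?gt_eqF// -[RHS]mule1 -f1; congr (_ * _)%E.
  by apply: eq_integral => x _; rewrite powRr1.
split => //.
- have iL : leb.-integrable E (fun t => (powR t (- (beta + 1)) * (beta * ln (t / c) +
  (-1)) * V t)%:E).
    apply: level_integrable.
    + exact: measurable_kernel.
    + by move=> t mt; rewrite mulr_ge0 ?powR_ge0// ln_c_ge0.
    + by rewrite HL ltry.
  have lnE t : m <= t -> (powR t (- (beta + 1)) * ln t * V t)%:E =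
      (beta^-1%:E * (powR t (- (beta + 1)) * (beta * ln (t / c) + (-1)) * V t)%:E +
       (ln c + beta^-1)%:E * (powR t (- (beta + 1)) * V t)%:E)%E.
    move=> mt; have t0 : 0 < t by exact: lt_le_trans mt.
    by rewrite -!EFinM -EFinD ln_div ?posrE//; congr EFin; field; rewrite gt_eqF.
  split.
    have := integrableD mE (integrableZl mE beta^-1 iL) (integrableZl mE (ln c +
      beta^-1) i0).
    apply: eq_integrable => //.
    by move=> t /Etm mt; rewrite lnE.
  transitivity (\int[leb]_(t in E) (beta^-1%:E * (powR t (- (beta + 1)) * (beta * ln (t
    / c) + (-1)) * V t)%:E +
       (ln c + beta^-1)%:E * (powR t (- (beta + 1)) * V t)%:E))%E.
    by apply: eq_integral => t /Etm mt; rewrite lnE.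
  rewrite integralD//; [|exact: integrableZl|exact: integrableZl].
  rewrite !integralZl// I0.
  have -> : (\int[leb]_(t in E) (powR t (- (beta + 1)) * (beta * ln (t / c) + (-1)) * V
    t)%:E =
      (H / beta - ln c)%:E)%E.
    by rewrite -HL; apply: eq_integral => t /Etm mt; rewrite -VE// EFinM.
  by rewrite -!EFinM -EFinD; congr EFin; field; rewrite gt_eqF.
- have [iq Iq] := pow q nq.
  have eE t : m <= t -> powR t (- (beta + 1)) * expR ((beta - q) * ln t) = powR t (- (q
    + 1)).
    move=> mt; have t0 : 0 < t by exact: lt_le_trans mt.
    by rewrite /powR gt_eqF// -expRD; congr expR; ring.
  split.
    by have := iq; apply: eq_integrable => // t /Etm mt; rewrite eE.
  by rewrite -Iq; apply: eq_integral => t /Etm mt; rewrite eE.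
Qed.

End tame.
End moments.

(** * Comparison with the Pareto density *)

Section comparison.
Context {R : realType}.
Local Notation leb := (@lebesgue_measure R).

Lemma moment_comparison n (beta q m Cf Cg : R) (f g : n.-tuple R -> R) :
  n%:R < beta -> n%:R < q -> is_density f -> is_density g -> 0 < m ->
  level_volume beta f m = 0%E -> level_volume beta g m = 0%E ->
  0 <= Cf -> 0 <= Cg ->
  (forall t, m <= t -> (level_volume beta f t <= (Cf * t ^+ n)%:E)%E) ->
  (forall t, m <= t -> (level_volume beta g t <= (Cg * t ^+ n)%:E)%E) ->
  entropy f = entropy g ->
  (forall s t r, m <= s -> s < t -> t < r ->
    fine (level_volume beta g s) < fine (level_volume beta f s) ->
    fine (level_volume beta g r) < fine (level_volume beta f r) ->
    fine (level_volume beta g t) < fine (level_volume beta f t)) ->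
  (\int[@lebesgue_n R n]_x (powR (f x) (q / beta))%:E <=
   \int[@lebesgue_n R n]_x (powR (g x) (q / beta))%:E)%E.
Proof.
move=> nbeta nq fd gd m0 fm gm Cf0 Cg0 fC gC fg cross.
have q0 : 0 < q by exact: le_lt_trans nq.
have [Hf [fH [if0 If0] [if1 If1] [ifq Ifq]]] := level_moments nbeta fd m0 fm Cf0 fC nq.
have [Hg [gH [ig0 Ig0] [ig1 Ig1] [igq Igq]]] := level_moments nbeta gd m0 gm Cg0 gC nq.
have HE : Hf = Hg by move: fg; rewrite fH gH => -[].
have mE : @measurable _ (measurableTypeR R) `[m, +oo[%classic by exact: measurable_itv.
pose V t := fine (level_volume beta f t); pose W t := fine (level_volume beta g t).
pose w t := powR t (- (beta + 1)).
have diff (k : R -> R) : leb.-integrable `[m, +oo[%classic (fun t => (k t * V t)%:E) ->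
    leb.-integrable `[m, +oo[%classic (fun t => (k t * W t)%:E) ->
    leb.-integrable `[m, +oo[%classic (fun t => (k t * (V t - W t))%:E) /\
    (\int[leb]_(t in `[m, +oo[) (k t * (V t - W t))%:E =
     \int[leb]_(t in `[m, +oo[) (k t * V t)%:E - \int[leb]_(t in `[m, +oo[) (k t * W
       t)%:E)%E.
  move=> iV iW; split.
    by have := integrableB mE iV iW; apply: eq_integrable => // t _; rewrite mulrBr EFinB.
  by rewrite -integralB//; apply: eq_integral => t _; rewrite mulrBr EFinB.
have [i0 I0] := diff w if0 ig0.
have [i1 I1] := diff (fun t => w t * ln t) if1 ig1.
have [iq Iq] := diff (fun t => w t * expR ((beta - q) * ln t)) ifq igq.
have := @crossing_comparison R m (beta - q) w (fun t => V t - W t) m0 _ i0 i1 iq _ _ _.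
rewrite Iq I0 I1 If0 Ig0 If1 Ig1 HE !subee// Ifq Igq => H.
have {H} : (q^-1%:E * \int[@lebesgue_n R n]_x (powR (f x) (q / beta))%:E -
    q^-1%:E * \int[@lebesgue_n R n]_x (powR (g x) (q / beta))%:E <= 0)%E.
  apply: H => //.
  - by move=> t mt; apply: powR_gt0; exact: lt_le_trans mt.
  - by move=> s t r ms st tr; rewrite !subr_gt0; exact: cross.
(* Finiteness of the second moment turns the sign of the difference into a comparison. *)
have gfin : (q^-1%:E * \int[@lebesgue_n R n]_x (powR (g x) (q / beta))%:E)%E \is a
  fin_num.
  by rewrite -Igq; exact: integrable_fin_num.
by rewrite leeBlDr// add0e lee_pmul2l// lte_fin invr_gt0.
Qed.

Lemma density_level_bounds n (beta : R) (f : n.-tuple R -> R) :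
  (0 < n)%N -> n%:R < beta -> is_density f -> neg_inv_concave beta f ->
  (exists2 m, 0 < m & level_volume beta f m = 0%E) /\
  (forall m, 0 < m -> exists2 C, 0 <= C &
    forall t, m <= t -> (level_volume beta f t <= (C * t ^+ n)%:E)%E).
Proof.
move=> n0 nbeta [mf [f0 f1]] fconc.
have beta0 : 0 < beta by exact: le_lt_trans nbeta.
have [v v0 vE] : exists2 v : R -> R, (forall t, 0 <= v t) &
    forall t, 0 < t -> level_volume beta f t = (v t ^+ n)%:E.
  (* Markov makes the level volume finite for [t > 0], so this root loses nothing there. *)
  exists (fun t => powR (fine (level_volume beta f t)) n%:R^-1).
    by move=> t; exact: powR_ge0.
  move=> t t0; rewrite -powR_mulrn ?powR_ge0// -powRrM mulVf ?pnatr_eq0 -?lt0n//.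
  rewrite powRr1 ?fine_ge0 ?level_volume_ge0// fineK// ge0_fin_numE ?level_volume_ge0//.
  by rewrite (le_lt_trans (level_volume_markov beta mf f0 t0 f1))// ltry.
have [|||[m m0 vm] bound] := @level_bounds R n beta v n0 nbeta v0.
- move=> s t s0 st; have t0 : 0 < t by exact: lt_le_trans st.
  have := level_volume_le beta0 mf s0 st.
  by rewrite vE// vE// lee_fin ler_pXn2r// nnegrE.
- move=> s t l s0 t0 l01 vs vt; have /andP[l0 l1] := l01.
  have r0 : 0 < (1 - l) * s + l * t by rewrite addr_gt0// mulr_gt0// subr_gt0.
  have := level_volume_concave beta0 mf fconc s0 t0 l01 vs vt.
  rewrite (vE s s0) (vE t t0) (vE _ r0) => /(_ (lexx _) (lexx _)).
  rewrite lee_fin ler_pXn2r// nnegrE//.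
  by rewrite addr_ge0// mulr_ge0 ?(ltW l0)// subr_ge0 ltW.
- by move=> t t0; rewrite -lee_fin -vE//; exact: level_volume_markov.
split.
  by exists m => //; rewrite vE// vm expr0n gtn_eqF.
move=> m' m'0; have [C HC] := bound m' m'0; exists C.
  have := le_trans (exprn_ge0 n (v0 m')) (HC m' (lexx _)).
  by rewrite pmulr_lge0// exprn_gt0.
move=> t mt; have t0 : 0 < t by exact: lt_le_trans mt.
by rewrite vE// lee_fin HC.
Qed.

End comparison.

(** * Moments, entropy and level volumes of the Pareto density *)

Section pareto.
Context {R : realType}.
Variables (n : nat) (a beta : R).
Hypothesis a0 : 0 < a.
Hypothesis nbeta : n%:R < beta.
Local Notation mu := (@lebesgue_n R n).
Local Notation Z := (pareto_Z n a beta).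
Local Notation g := (@pareto_density R n a beta).

Let beta0 : 0 < beta. Proof. exact: le_lt_trans nbeta. Qed.

Lemma ln_prod (r : seq nat) (F : nat -> R) : (forall i, i \in r -> 0 < F i) ->
  0 < \prod_(i <- r) F i /\ ln (\prod_(i <- r) F i) = \sum_(i <- r) ln (F i).
Proof.
elim: r => [|i r IH] H; first by rewrite !big_nil ln1.
have Fi : 0 < F i by apply: H; rewrite mem_head.
have [|P0 PE] := IH; first by move=> j jr; apply: H; rewrite in_cons jr orbT.
by rewrite !big_cons mulr_gt0// lnM ?posrE// PE.
Qed.

Lemma prod_shift_gt0 (q : R) : n%:R < q ->
  0 < \prod_(1 <= i < n.+1) (q - i%:R) /\
  ln (\prod_(1 <= i < n.+1) (q - i%:R)) = \sum_(1 <= i < n.+1) ln (q - i%:R).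
Proof.
move=> nq; apply: ln_prod => i; rewrite mem_index_iota => /andP[_ ilt].
by rewrite subr_gt0 (le_lt_trans _ nq)// ler_nat.
Qed.

Lemma pareto_unnormE (q : R) (x : n.-tuple R) : pareto_unnorm a q x = pareto_ln a q 1 0
  1 x.
Proof.
by rewrite /pareto_unnorm /pareto_ln /positive_tuple /tuple_sum mul0r add0r mulr1.
Qed.

Lemma integral_pareto_unnorm (q : R) : n%:R < q ->
  (\int[mu]_x (pareto_unnorm a q x)%:E =
   (powR a (n%:R - q) / \prod_(1 <= i < n.+1) (q - i%:R))%:E)%E.
Proof.
move=> nq; under eq_integral do rewrite pareto_unnormE.
by rewrite integral_pareto_ln// ?mul0r ?add0r// addr0 mulr1.
Qed.

Lemma pareto_ZE : Z = powR a (n%:R - beta) / \prod_(1 <= i < n.+1) (beta - i%:R).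
Proof. by rewrite /pareto_Z integral_pareto_unnorm. Qed.

Lemma pareto_Z_gt0 : 0 < Z.
Proof. by rewrite pareto_ZE divr_gt0 ?powR_gt0//; have [] := prod_shift_gt0 nbeta. Qed.

Lemma ln_pareto_Z : ln Z = (n%:R - beta) * ln a - \sum_(1 <= i < n.+1) ln (beta - i%:R).
Proof.
have [P0 PE] := prod_shift_gt0 nbeta.
by rewrite pareto_ZE ln_div ?posrE ?powR_gt0// ln_powR PE.
Qed.

Lemma measurable_pareto_unnorm (q : R) : measurable_fun [set: n.-tuple R]
  (@pareto_unnorm R n a q).
Proof.
rewrite (_ : @pareto_unnorm R n a q = pareto_ln a q 1 0 1).
  exact: measurable_pareto_ln.
by apply/funext => x; rewrite pareto_unnormE.
Qed.

Lemma pareto_unnorm_ge0 (q : R) (x : n.-tuple R) : 0 <= pareto_unnorm a q x.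
Proof. by rewrite /pareto_unnorm; case: ifPn => // _; exact: powR_ge0. Qed.

Lemma pareto_density_is_density : is_density g.
Proof.
have Z0 := pareto_Z_gt0; split; first by apply: measurable_funM => //; exact:
  measurable_pareto_unnorm.
split; first by move=> x; rewrite mulr_ge0 ?pareto_unnorm_ge0// invr_ge0 ltW.
rewrite /pareto_density; under eq_integral do rewrite EFinM.
rewrite ge0_integralZl//; last 3 first.
- by apply/measurable_EFinP; exact: measurable_pareto_unnorm.
- by move=> x _; rewrite lee_fin pareto_unnorm_ge0.
- by rewrite lee_fin invr_ge0 ltW.
by rewrite integral_pareto_unnorm// -pareto_ZE -EFinM mulVf// gt_eqF.
Qed.

Lemma powR_pareto_density (p : R) (x : n.-tuple R) : p != 0 ->
  powR (g x) p = powR Z (- p) * pareto_unnorm a (p * beta) x.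
Proof.
move=> p0; have Z0 := pareto_Z_gt0.
rewrite /pareto_density /pareto_unnorm; case: ifPn => [xpos|_]; last by rewrite !mulr0
  powR0.
rewrite powRM ?invr_ge0 ?powR_ge0 ?(ltW Z0)//; congr (_ * _).
  by rewrite /powR invr_eq0 gt_eqF// lnV ?posrE// mulrN mulNr.
by rewrite -powRrM; congr powR; ring.
Qed.

Lemma entropy_pareto : entropy g =
  (beta * \sum_(1 <= i < n.+1) (beta - i%:R)^-1 + ln Z + beta * ln a)%:E.
Proof.
have Z0 := pareto_Z_gt0; have [mg [g0 g1]] := pareto_density_is_density.
set T := \sum_(1 <= i < n.+1) _.
(* Measuring the logarithm from [ln a] makes it nonnegative on the support, where the argument is at
   least [a]. *)
have lna : 0 <= beta * ln (a / a) + 0 by rewrite divff ?gt_eqF// ln1 mulr0 addr0.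
have IA : (\int[mu]_x (pareto_ln a beta a beta 0 x)%:E = (Z * (beta * T))%:E)%E.
  rewrite integral_pareto_ln ?(ltW beta0)// -pareto_ZE divff ?gt_eqF// ln1.
  by rewrite mulr0 !add0r.
have iA : mu.-integrable setT (fun x => (pareto_ln a beta a beta 0 x)%:E).
  apply/integrableP; split; first by apply/measurable_EFinP; exact: measurable_pareto_ln.
  under eq_integral do rewrite gee0_abs ?lee_fin ?pareto_ln_ge0 ?(ltW beta0)//.
  by rewrite IA ltry.
have ig : mu.-integrable setT (fun x => (g x)%:E).
  apply/integrableP; split; first exact/measurable_EFinP.
  under eq_integral do rewrite gee0_abs ?lee_fin//.
  by rewrite g1 ltry.
rewrite /entropy.
transitivity (- \int[mu]_x ((- Z^-1)%:E * (pareto_ln a beta a beta 0 x)%:E +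
    (- (ln Z + beta * ln a))%:E * (g x)%:E))%E.
  congr (- _)%E; apply: eq_integral => x _; rewrite -!EFinM -EFinD; congr EFin.
  rewrite /pareto_density pareto_unnormE /pareto_ln; case: ifPn => [xpos|_]; last by
    rewrite !mulr0 mul0r addr0.
  have u0 : 0 < a + tuple_sum x by rewrite ltr_wpDr// tuple_sum_ge0.
  have lng : ln (Z^-1 * powR (a + tuple_sum x) (- beta)) = - ln Z - beta * ln (a +
    tuple_sum x).
    by rewrite lnM ?posrE ?invr_gt0 ?powR_gt0// lnV ?posrE// ln_powR mulNr.
  rewrite mul0r add0r mulr1 lng ln_div ?posrE//.
  ring.
rewrite integralD//; [|exact: integrableZl|exact: integrableZl].
rewrite !integralZl// IA g1 mule1 -EFinM -EFinD -EFinN; congr EFin.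
by field; rewrite gt_eqF.
Qed.

(** The powers of [a] coming from the entropy, from the normalizing constant and from the integral
    cancel. *)
Lemma exp_moment_pareto alpha : alpha < 1 - n%:R / beta ->
  exp_moment g alpha = (expR (psi_c n beta alpha))%:E.
Proof.
move=> alphalt; have Z0 := pareto_Z_gt0; have [mg [g0 g1]] := pareto_density_is_density.
have alpha1 : alpha < 1.
  by apply: (lt_le_trans alphalt); rewrite lerBlDr lerDl divr_ge0 ?ler0n ?ltW.
have nq : n%:R < (1 - alpha) * beta.
  by rewrite -ltr_pdivrMr//; move: alphalt; rewrite !ltrBrDr addrC.
rewrite (exp_momentE mg g0 entropy_pareto)//.
under eq_integral do rewrite powR_pareto_density ?subr_eq0 1?eq_sym ?(lt_eqF alpha1)//
  EFinM.
rewrite ge0_integralZl//; last 3 first.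
- by apply/measurable_EFinP; exact: measurable_pareto_unnorm.
- by move=> x _; rewrite lee_fin pareto_unnorm_ge0.
- by rewrite lee_fin powR_ge0.
rewrite integral_pareto_unnorm// -!EFinM; congr EFin.
have [P0 PE] := prod_shift_gt0 nq.
rewrite -[\prod_(1 <= i < n.+1) _](@lnK R) ?posrE// PE.
rewrite /powR !gt_eqF// -expRN -!expRD; congr expR.
rewrite ln_pareto_Z /psi_c.
rewrite (_ : \sum_(1 <= i < n.+1) ln (((1 - alpha) * beta - i%:R) / (beta - i%:R)) =
  \sum_(1 <= i < n.+1) ln ((1 - alpha) * beta - i%:R) - \sum_(1 <= i < n.+1) ln (beta -
    i%:R)).
  ring.
rewrite -sumrB !big_seq; apply: eq_bigr => i; rewrite mem_index_iota => /andP[_ ilt].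
have iln : i%:R <= n%:R :> R by rewrite ler_nat.
by rewrite ln_div ?posrE// subr_gt0 (le_lt_trans iln).
Qed.

(** On the positive orthant [phi = g^(-1/beta)] is [k * (a + tuple_sum x)], so its sublevel sets are
    simplices of size [t / k - a]. *)
Let k := powR Z beta^-1.
Let k0 : 0 < k. Proof. by rewrite powR_gt0// pareto_Z_gt0. Qed.

Lemma level_volume_pareto t : 0 < t -> level_volume beta g t =
  (if 0 < t / k - a then (t / k - a) ^+ n / n`!%:R else 0)%:E.
Proof.
move=> t0; have Z0 := pareto_Z_gt0.
rewrite -simplex_volume /level_volume; congr (mu _).
apply/seteqP; split => x /=; rewrite /simplex/= /pareto_density pareto_unnormE /pareto_ln.
- case: ifPn => [xpos|_]; last by rewrite mulr0 ltNge powR_ge0.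
  have u0 : 0 < a + tuple_sum x by rewrite ltr_wpDr// tuple_sum_ge0.
  rewrite mul0r add0r mulr1 => H; split => //.
  rewrite ltrBrDl ltr_pdivlMr//; move: H.
  rewrite -[X in X * _](_ : powR k (- beta) = _); last first.
    by rewrite /k -powRrM mulrN mulVf ?gt_eqF// powR_inv1// ltW.
  by rewrite -powRM ?(ltW k0) ?(ltW u0)// ltr_powRN ?mulr_gt0// mulrC.
- move=> [xpos H]; rewrite xpos.
  have u0 : 0 < a + tuple_sum x by rewrite ltr_wpDr// tuple_sum_ge0.
  move: H; rewrite ltrBrDl ltr_pdivlMr// mul0r add0r mulr1 => H.
  rewrite -[X in X * _](_ : powR k (- beta) = _); last first.
    by rewrite /k -powRrM mulrN mulVf ?gt_eqF// powR_inv1// ltW.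
  by rewrite -powRM ?(ltW k0) ?(ltW u0)// ltr_powRN ?mulr_gt0// mulrC.
Qed.

Lemma level_volume_pareto_eq0 : level_volume beta g (a * k) = 0%E.
Proof.
by rewrite level_volume_pareto ?mulr_gt0// mulfK ?gt_eqF// subrr ltxx.
Qed.

Lemma level_volume_pareto_le t : 0 < t ->
  (level_volume beta g t <= ((k ^+ n)^-1 / n`!%:R * t ^+ n)%:E)%E.
Proof.
move=> t0; rewrite level_volume_pareto// lee_fin; case: ifPn => [pos|_]; last first.
  by rewrite !mulr_ge0 ?invr_ge0 ?exprn_ge0 ?ler0n ?ltW.
rewrite mulrAC ler_wpM2r ?invr_ge0 ?ler0n//.
rewrite (_ : (k ^+ n)^-1 * t ^+ n = (t / k) ^+ n); last by rewrite expr_div_n mulrC.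
have tk0 : 0 <= t / k by rewrite divr_ge0 ?ltW.
apply: lerXn2r; rewrite ?nnegrE ?(ltW pos)//.
by rewrite lerBlDr lerDl ltW.
Qed.

(** The root of the level volume of [f] lies above its chord from [s] to [r], while the Pareto root
    [w] is convex and lies below its own; strict inequality at the ends passes to [t]. *)
Lemma pareto_level_crossing (f : n.-tuple R -> R) s t r : (0 < n)%N ->
  is_density f -> neg_inv_concave beta f -> 0 < s -> s < t -> t < r ->
  fine (level_volume beta g s) < fine (level_volume beta f s) ->
  fine (level_volume beta g r) < fine (level_volume beta f r) ->
  fine (level_volume beta g t) < fine (level_volume beta f t).
Proof.
move=> n0 [mf [f0 f1]] fconc s0 st tr.
have t0 : 0 < t by exact: lt_trans st.
have r0 : 0 < r by exact: lt_trans tr.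
have VE u : 0 < u -> (fine (level_volume beta f u))%:E = level_volume beta f u.
  move=> u0; rewrite fineK// ge0_fin_numE ?level_volume_ge0//.
  by rewrite (le_lt_trans (level_volume_markov beta mf f0 u0 f1))// ltry.
have nf0 : (0 : R) < n`!%:R^-1 by rewrite invr_gt0 ltr0n fact_gt0.
have [e e0 en] := root_exists n0 nf0.
(* The positive part keeps [w] convex also across the point where the Pareto level volume starts. *)
pose w u := e * Num.max 0 (u / k - a).
have w0 u : 0 <= w u by rewrite mulr_ge0 ?(ltW e0)// le_max lexx.
have WE u : 0 < u -> fine (level_volume beta g u) = w u ^+ n.
  move=> u0; rewrite level_volume_pareto//= /w exprMn en.
  case: ifPn => [pos|]; first by rewrite max_r ?(ltW pos)// mulrC.
  by rewrite -leNgt => neg; rewrite max_l// expr0n gtn_eqF// mulr0.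
have root u : 0 < u -> fine (level_volume beta g u) < fine (level_volume beta f u) ->
    exists2 x, w u < x & x ^+ n = fine (level_volume beta f u).
  move=> u0; rewrite WE// => wV.
  have [x x0 xV] := root_exists n0 (le_lt_trans (exprn_ge0 n (w0 u)) wV).
  exists x => //; move: wV; rewrite -xV ltr_pXn2r// nnegrE//; exact: ltW.
move=> /(root _ s0)[x wx xV] /(root _ r0)[y wy yV].
pose l := (t - s) / (r - s).
have rs0 : 0 < r - s by rewrite subr_gt0 (lt_trans st).
have l0 : 0 < l by rewrite divr_gt0// subr_gt0.
have l1 : l < 1 by rewrite ltr_pdivrMr// mul1r ltrD2r.
have tE : (1 - l) * s + l * r = t by rewrite /l; field; rewrite gt_eqF.
have x0 : 0 < x by exact: le_lt_trans wx.
have y0 : 0 < y by exact: le_lt_trans wy.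
have l01 : 0 < l < 1 by rewrite l0.
have := level_volume_concave beta0 mf fconc s0 r0 l01 x0 y0.
rewrite xV yV (VE s s0) (VE r r0) => /(_ (lexx _) (lexx _)); rewrite tE -(VE t t0)
  lee_fin.
apply: lt_le_trans; rewrite WE// ltr_pXn2r ?nnegrE//; last first.
  by rewrite addr_ge0// mulr_ge0 ?subr_ge0 ?ltW.
apply: (@le_lt_trans _ _ ((1 - l) * w s + l * w r)); last first.
  by rewrite ltrD// ltr_pM2l// subr_gt0.
rewrite /w !(mulrCA _ e) -mulrDr ler_pM2l// ge_max; apply/andP; split.
  by rewrite addr_ge0// mulr_ge0 ?(ltW l0) ?subr_ge0 ?(ltW l1)// le_max lexx.
rewrite -tE (_ : _ / k - a = (1 - l) * (s / k - a) + l * (r / k - a)); last by ring.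
by rewrite lerD// ler_wpM2l ?(ltW l0) ?subr_ge0 ?(ltW l1)// le_max lexx orbT.
Qed.

End pareto.

Theorem theorem4p6 (R : realType) (n : nat) (beta : R) :
  n%:R < beta ->
  (forall f : n.-tuple R -> R,
     is_density f -> neg_inv_concave beta f ->
     forall alpha : R, alpha < 1 - n%:R / beta ->
       (exp_moment f alpha <= (expR (psi_c n beta alpha))%:E)%E)
  /\
  (forall a : R, 0 < a ->
     forall alpha : R, alpha < 1 - n%:R / beta ->
       exp_moment (@pareto_density R n a beta) alpha = (expR (psi_c n beta alpha))%:E).
Proof.
move=> nbeta; split; last by move=> a a0 alpha alphalt; exact: exp_moment_pareto.
move=> f fd fconc alpha alphalt.
have beta0 : 0 < beta by exact: le_lt_trans nbeta.
have [mf [f0 f1]] := fd.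
have alpha1 : alpha < 1.
  by apply: (lt_le_trans alphalt); rewrite lerBlDr lerDl divr_ge0 ?ler0n ?ltW.
have nq : n%:R < (1 - alpha) * beta.
  by rewrite -ltr_pdivrMr//; move: alphalt; rewrite !ltrBrDr addrC.
have [n0|n0] := posnP n.
  (* In dimension 0 the density is the constant 1 and both sides equal 1. *)
  subst n; have fE : f [tuple] = 1 by move: f1; rewrite integral_lebesgue_0 => -[].
  have fH : entropy f = 0%:E.
    by rewrite /entropy integral_lebesgue_0 fE ln1 mulr0 oppe0.
  rewrite (exp_momentE mf f0 fH)// integral_lebesgue_0 fE powR1 mule1.
  by rewrite /psi_c !big_geq// !mulr0 subr0.
have [[mf0 mf00 fm] fbound] := density_level_bounds n0 nbeta fd fconc.
have [C1 C10 fC1] := fbound mf0 mf00.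
have [H [fH _ _ _]] := level_moments nbeta fd mf00 fm C10 fC1 nq.
(* The solution of [entropy_pareto = H], an equation affine in [ln a] with slope [n]. *)
pose a := expR ((H - beta * \sum_(1 <= i < n.+1) (beta - i%:R)^-1 +
  \sum_(1 <= i < n.+1) ln (beta - i%:R)) / n%:R).
have a0 : 0 < a by exact: expR_gt0.
have gd := pareto_density_is_density a0 nbeta.
have [mg [g0 g1]] := gd.
have gH : entropy (@pareto_density R n a beta) = H%:E.
  rewrite entropy_pareto// ln_pareto_Z// /a expRK; congr EFin.
  by field; rewrite pnatr_eq0 -lt0n.
rewrite -(exp_moment_pareto a0 nbeta alphalt).
(* Equal entropies give equal prefactors, so only the integrals of the powers [1 - alpha] remain to
   be compared. *)
rewrite (exp_momentE mf f0 fH)// (exp_momentE mg g0 gH)//.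
rewrite lee_pmul2l// ?lte_fin ?expR_gt0//.
have -> : 1 - alpha = (1 - alpha) * beta / beta by rewrite mulfK// gt_eqF.
pose k := powR (pareto_Z n a beta) beta^-1.
have k0 : 0 < k by rewrite powR_gt0// pareto_Z_gt0.
(* A common starting point at which both level volumes vanish. *)
pose m := Num.min mf0 (a * k).
have m0 : 0 < m by rewrite lt_min mf00 mulr_gt0.
have level0 h : measurable_fun [set: n.-tuple R] h -> forall M, m <= M ->
    level_volume beta h M = 0%E -> level_volume beta h m = 0%E.
  move=> mh M mM hM; apply/eqP; rewrite eq_le level_volume_ge0 andbT -hM.
  exact: level_volume_le.
have [C C0 fC] := fbound m m0.
apply: (@moment_comparison R n beta _ m C ((k ^+ n)^-1 / n`!%:R)) => //.
- by apply: (level0 f mf mf0) => //; rewrite ge_min lexx.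
- apply: (level0 _ mg (a * k)); first by rewrite ge_min lexx orbT.
  exact: level_volume_pareto_eq0.
- by rewrite divr_ge0 ?ler0n ?invr_ge0 ?exprn_ge0 ?ltW.
- by move=> t mt; apply: level_volume_pareto_le => //; exact: lt_le_trans mt.
- by rewrite fH gH.
- move=> s t r ms st tr; apply: pareto_level_crossing => //.
  exact: lt_le_trans ms.
Qed.
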